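(* Assume that $f_1,f_2$ satisfy Assumption (A) of the context, and let $X$ be the solution of the SDE in the context with deterministic initial condition $x_0\in\mathbb{R}^\kappa$. Then for all $t\ge0$, $k\in\{1,2\}$ and $j\in\{1,\dots,\eta_k+1\}$, $$\mathcal{I}^{k,j}_{\min}\le\mathbb{E}[X^{k,j}_t]\le\mathcal{I}^{k,j}_{\max},$$ where $$\mathcal{I}^{k,j}_{\min}=\left(e^{At}x_0\right)^{k,j}+\left[1-e^{-t\nu_k}\sum_{l=0}^{\eta_k+1-j}\frac{(t\nu_k)^l}{l!}\right]\min\left\{0,\frac{c_kf^{\max}_{k+1}}{\nu_k^{\eta_k+2-j}}\right\},$$ $$\mathcal{I}^{k,j}_{\max}=\left(e^{At}x_0\right)^{k,j}+\left[1-e^{-t\nu_k}\sum_{l=0}^{\eta_k+1-j}\frac{(t\nu_k)^l}{l!}\right]\max\left\{0,\frac{c_kf^{\max}_{k+1}}{\nu_k^{\eta_k+2-j}}\right\}.$$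
   Context: Parameters: integers $\eta_1,\eta_2\ge1$, reals $\nu_1,\nu_2>0$, $c_1,c_2\in\{-1,+1\}$, $\kappa=\eta_1+\eta_2+2$, an integer $N\ge1$, and $p_1,p_2>0$ with $p_1+p_2=1$. The index $k\in\{1,2\}$ is cyclic (index $3$ means $1$). Assumption (A): $f_1,f_2:\mathbb{R}\to\mathbb{R}$ are Lipschitz continuous, non-decreasing, and $0<f_k\le f_k^{\max}<\infty$ for $k=1,2$. A vector $x\in\mathbb{R}^\kappa$ is written $x=(x^1,x^2)$ with $x^k=(x^{k,1},\dots,x^{k,\eta_k+1})\in\mathbb{R}^{\eta_k+1}$. $A\in\mathbb{R}^{\kappa\times\kappa}$ is block-diagonal with blocks $A_{\nu_1},A_{\nu_2}$, where $A_{\nu_k}$ is the $(\eta_k+1)\times(\eta_k+1)$ matrix with $-\nu_k$ on the diagonal, $1$ on the first superdiagonal and $0$ elsewhere. SDE: $X=(X^1,X^2)^T\in\mathbb{R}^\kappa$ is the unique strong solution of $dX_t=(AX_t+B(X_t))\,dt+\frac1{\sqrt N}\sigma(X_t)\,dW_t$, $X_0=x_0$, with $W=(W^1,W^2)^T$ a 2-dimensional Brownian motion. Here $B:\mathbb{R}^\kappa\to\mathbb{R}^\kappa$ has all components zero except $(B(x))^{1,\eta_1+1}=c_1f_2(x^{2,1})$ and $(B(x))^{2,\eta_2+1}=c_2f_1(x^{1,1})$; $\sigma:\mathbb{R}^\kappa\to\mathbb{R}^{\kappa\times2}$ has all entries zero except the entry in row $(1,\eta_1+1)$, column $2$, equal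 to $\frac{c_1}{\sqrt{p_2}}\sqrt{f_2(x^{2,1})}$, and the entry in row $(2,\eta_2+1)$, column $1$, equal to $\frac{c_2}{\sqrt{p_1}}\sqrt{f_1(x^{1,1})}$. *)

(* Defs.v *)
From HB Require Import structures.
From mathcomp Require Import all_boot all_order all_algebra.
From mathcomp Require Import all_classical all_reals all_analysis.

Set Implicit Arguments.
Unset Strict Implicit.
Unset Printing Implicit Defensive.

Import Order.TTheory GRing.Theory Num.Theory.
Import numFieldNormedType.Exports.

Local Open Scope classical_set_scope.
Local Open Scope ring_scope.

Definition expmx (R : realType) (n : nat) (M : 'M[R]_n) : 'M[R]_n :=
  \matrix_(i, j) lim (series (fun m => (m`!%:R^-1 *: M ^+ m) i j) @ \oo).

(* Processes are functions of a time [t : R] and of [w : Omega]; only their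
   values at times [0 <= t] matter.  A sub-sigma-algebra is a [set (set Omega)],
   a filtration a map [R -> set (set Omega)]. *)

Definition measurable_wrt (R : realType) (Omega : Type) (G : set (set Omega))
    (Y : Omega -> R) : Prop :=
  preimage_set_system setT Y measurable `<=` G.

Definition natural_filtration (R : realType) (Omega : Type) (m : nat)
    (W : 'I_m -> R -> Omega -> R) (t : R) : set (set Omega) :=
  <<s [set A | exists l u, 0 <= u <= t /\
                 preimage_set_system setT (W l u) measurable A] >>.

Definition augmented_filtration (d : measure_display) (Omega : measurableType d)
    (R : realType) (P : probability Omega R) (m : nat)
    (W : 'I_m -> R -> Omega -> R) (t : R) : set (set Omega) :=
  <<s natural_filtration W t `|` [set A | measurable A /\ P A = 0%E] >>.

(* The last field says at once that the increments over [s, t] of the [m]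
   components are independent of each other and of the past up to time [s].
   The second parameter of [normal_prob] is the standard deviation. *)
Record brownian_motion (d : measure_display) (Omega : measurableType d)
    (R : realType) (P : probability Omega R) (m : nat)
    (W : 'I_m -> R -> Omega -> R) : Prop := {
  bm_measurable : forall l t, 0 <= t -> measurable_fun setT (W l t) ;
  bm_continuous : forall l w, {within `[0, +oo[, continuous (fun t => W l t w)} ;
  bm_start : forall l, {ae P, forall w, W l 0 w = 0} ;
  bm_gaussian : forall l s t, 0 <= s < t -> forall B : set R, measurable B ->
    P [set w | B (W l t w - W l s w)] = normal_prob 0 (Num.sqrt (t - s)) B ;
  bm_independent : forall s t, 0 <= s < t ->
    forall (A : set Omega) (B : 'I_m -> set R),
    natural_filtration W s A -> (forall l, measurable (B l)) ->
    P (A `&` [set w | forall l, B l (W l t w - W l s w)]) =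
    (P A * \prod_(l < m) P [set w | B l (W l t w - W l s w)%R])%E }.

(* The process equal to [sp_value i] on the time interval
   ]sp_time i, sp_time i.+1] for [i < sp_size], and to 0 elsewhere. *)
Record simple_process (R : realType) (Omega : Type)
    (F : R -> set (set Omega)) := SimpleProcess {
  sp_size : nat ;
  sp_time : nat -> R ;
  sp_value : nat -> Omega -> R ;
  sp_time_ge0 : 0 <= sp_time 0%N ;
  sp_time_nondecreasing : nondecreasing_seq sp_time ;
  sp_value_adapted : forall i, measurable_wrt (F (sp_time i)) (sp_value i) ;
  sp_value_bounded : forall i, exists K, forall w, `|sp_value i w| <= K }.

Definition simple_eval (R : realType) (Omega : Type) (F : R -> set (set Omega))
    (S : simple_process F) (s : R) (w : Omega) : R :=
  \sum_(i < sp_size S) sp_value S i w *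
    \1_(`]sp_time S i, sp_time S i.+1]) s.

Definition simple_integral (R : realType) (Omega : Type)
    (F : R -> set (set Omega)) (S : simple_process F) (V : R -> Omega -> R)
    (t : R) (w : Omega) : R :=
  \sum_(i < sp_size S) sp_value S i w *
    (V (Num.min (sp_time S i.+1) t) w - V (Num.min (sp_time S i) t) w).

(* [is_ito_integral P F V H t I] : the random variable [I] is (a version of)
   the Itô integral of [H] over [0, t] with respect to the Brownian motion [V],
   i.e. the L^2 limit of integrals of simple processes approximating [H] in
   L^2(dP x ds).  Such an approximation exists exactly when the measurable
   adapted process [H] satisfies E[int_0^t H_s^2 ds] < +oo, which always holds
   for bounded integrands. *)
Definition is_ito_integral (d : measure_display) (Omega : measurableType d)
    (R : realType) (P : probability Omega R) (F : R -> set (set Omega))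
    (V : R -> Omega -> R) (H : R -> Omega -> R) (t : R) (I : Omega -> R) : Prop :=
  [/\ measurable_fun (`[0, t] `*` [set: Omega]) (fun z => H z.1 z.2),
      forall s, 0 <= s <= t -> measurable_wrt (F s) (H s),
      measurable_fun setT I &
      exists S : nat -> simple_process F,
        ((fun n => \int[P]_w \int[lebesgue_measure]_(s in `[0%R, t])
                     ((simple_eval (S n) s w - H s w) ^+ 2)%R%:E)%E
           @ \oo --> 0%E) /\
        ((fun n => 'E_P[fun w => ((simple_integral (S n) V t w - I w) ^+ 2)%R])%E
           @ \oo --> 0%E)].

(* Strong solution of dX_t = b(X_t) dt + a(X_t) dW_t, X_0 = x0, for a
   deterministic [x0] and bounded [a]. *)
Record strong_solution (d : measure_display) (Omega : measurableType d)
    (R : realType) (P : probability Omega R) (m n : nat)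
    (W : 'I_m -> R -> Omega -> R) (b : 'cV[R]_n -> 'cV[R]_n)
    (a : 'cV[R]_n -> 'M[R]_(n, m)) (x0 : 'cV[R]_n)
    (X : R -> Omega -> 'cV[R]_n) : Prop := {
  sol_adapted : forall t i, 0 <= t ->
    measurable_wrt (augmented_filtration P W t) (fun w => X t w i 0) ;
  sol_continuous : forall w i,
    {within `[0, +oo[, continuous (fun t => X t w i 0)} ;
  sol_start : {ae P, forall w, X 0 w = x0} ;
  sol_equation : forall t, 0 <= t ->
    exists J : 'I_n -> 'I_m -> Omega -> R,
      (forall i l, is_ito_integral P (augmented_filtration P W) (W l)
                     (fun s w => a (X s w) i l) t (J i l)) /\
      (forall i, {ae P, forall w, X t w i 0 = x0 i 0
          + \int[lebesgue_measure]_(s in `[0, t]) (b (X s w) i 0)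
          + \sum_(l < m) J i l w}) }.

(* The two blocks are indexed by [k : 'I_2] (0 and 1 instead of 1 and 2), with
   cyclic successor [ordS k].  Components inside a block are indexed from 0, so
   that the j-th component of block k, 1 <= j <= eta k + 1, has index j - 1 in
   ['I_(eta k).+1].  The total dimension is kappa = eta_1 + eta_2 + 2. *)

Section System.
Context (R : realType) (eta : 'I_2 -> nat) (nu c p : 'I_2 -> R)
  (f : 'I_2 -> R -> R) (fmax : 'I_2 -> R).

Definition state : Type := 'cV[R]_(\sum_(k < 2) (eta k).+1).

Definition block_coord (x : state) (k : 'I_2) (j : 'I_(eta k).+1) : R :=
  submxcol x k j 0.

Definition assumptionA : Prop := forall k : 'I_2,
  [/\ lipschitz (f k : R^o -> R^o),
      {homo f k : x y / x <= y} &
      forall x, 0 < f k x <= fmax k].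

Definition blockA (n : nat) (v : R) : 'M[R]_n.+1 :=
  \matrix_(i, j) (if j == i then - v else ((j : nat) == i.+1)%:R).

Definition matA : 'M[R]_(\sum_(k < 2) (eta k).+1) :=
  \mxdiag_(k < 2) blockA (eta k) (nu k).

Definition vecB (x : state) : state :=
  \mxcol_(k < 2) \col_(j < (eta k).+1)
    (if j == ord_max then c k * f (ordS k) (block_coord x (k := ordS k) ord0)
     else 0).

Definition matSigma (x : state) : 'M[R]_(\sum_(k < 2) (eta k).+1, 2) :=
  \mxcol_(k < 2) \matrix_(j < (eta k).+1, l < 2)
    (if (j == ord_max) && (l == ordS k)
     then c k / Num.sqrt (p (ordS k)) *
          Num.sqrt (f (ordS k) (block_coord x (k := ordS k) ord0))
     else 0).

(* With the 0-based index [j], the exponents eta_k + 1 - j and eta_k + 2 - j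
   of the 1-based formulas become [eta k - j] and [(eta k - j).+1]. *)
Definition time_factor (t : R) (k : 'I_2) (j : 'I_(eta k).+1) : R :=
  1 - expR (- (t * nu k)) *
      \sum_(0 <= l < (eta k - j).+1) (t * nu k) ^+ l / l`!%:R.

Definition asymptote (k : 'I_2) (j : 'I_(eta k).+1) : R :=
  c k * fmax (ordS k) / nu k ^+ (eta k - j).+1.

Definition Imin (x0 : state) (t : R) (k : 'I_2) (j : 'I_(eta k).+1) : R :=
  block_coord (expmx (t *: matA) *m x0) j +
    time_factor t j * Num.min 0 (asymptote j).

Definition Imax (x0 : state) (t : R) (k : 'I_2) (j : 'I_(eta k).+1) : R :=
  block_coord (expmx (t *: matA) *m x0) j +
    time_factor t j * Num.max 0 (asymptote j).

End System.

(* Main.v *)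
(** Each coordinate solves a scalar linear equation driven by the next one and,
    for the last coordinate of a block, by the bounded rate [c f] plus an Itô
    integral.  Such an Itô integral has mean zero and an L^1 norm bounded on
    bounded time intervals: for simple integrands this is an orthogonality
    argument based on the independence of the increments, and it passes to the
    L^2 limit.  A pathwise comparison then bounds E|X_t|, so that Fubini applies
    and the mean m_q of the q-th coordinate from the end of a block satisfies
    m_q' = - nu m_q + m_(q-1) in integrated form, with m_(-1) = E[c f] lying
    between min(0, c fmax) and max(0, c fmax).  The right-hand sides of the
    theorem solve the same chain with m_(-1) replaced by these constants, and the
    equations compare monotonically by induction on q.  Finally the entries of
    the matrix exponential are exp(- nu t) t^r / r!, which identifies that chain
    with the closed formulas. *)

Require Import Defs.
From HB Require Import structures.
From mathcomp Require Import all_boot all_order all_algebra.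
From mathcomp Require Import all_classical all_reals all_analysis.
From mathcomp Require Import measurable_realfun ring lra zify.

Set Implicit Arguments.
Unset Strict Implicit.

Import Order.TTheory GRing.Theory Num.Theory.
Import numFieldNormedType.Exports.

Local Open Scope classical_set_scope.
Local Open Scope ring_scope.

(** * Moments of Gaussian increments *)

(** [strong_solution] supplies no moments of [X], and its Itô integrals are chosen anew at every
    time, with no regularity in [t]. Integrability therefore has to be earned before any expectation
    is taken: it comes from a bound that holds path by path and in whose right-hand side the bounded
    coordinate does not reappear. The equations for the means are not closed either, since [E[f(X)]]
    is not a function of [E[X]]. It enters as a bounded measurable forcing, so the equations are
    kept in integral form and compared there, without differentiating the means. The two blocks
    interact solely through this bounded forcing, which is why each block can be treated alone. From
    the noise only a first-moment bound and mean zero are extracted, so a crude constant may stand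
    for the exact Gaussian variance. *)

Section normal_moments.
Context {R : realType}.
Local Notation mu := (@lebesgue_measure R).

(** The change of variables yields the Radon-Nikodym derivative, which is determined only almost
    everywhere; it agrees with [normal_pdf] there because both have the same integral over every
    measurable set. *)
Lemma ge0_integral_normal_prob (m s : R) (f : R -> \bar R) :
  measurable_fun setT f -> (forall x, 0 <= f x)%E ->
  (\int[normal_prob m s]_x f x =
   \int[mu]_x (f x * (normal_pdf m s x)%:E))%E.
Proof.
move=> mf f0; have dom := normal_prob_dominates m s.
rewrite -(Radon_Nikodym_SigmaFinite.change_of_variables dom)//.
apply: ae_eq_integral => //.
- apply: emeasurable_funM => //; apply: (measurable_int mu).
  exact: Radon_Nikodym_SigmaFinite.f_integrable.
- apply: emeasurable_funM => //; apply/measurable_EFinP.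
  exact: measurable_normal_pdf.
- apply: ae_eqe_mul2l; apply: integral_ae_eq => //.
  + exact: Radon_Nikodym_SigmaFinite.f_integrable.
  + by apply/measurable_EFinP; exact: measurable_normal_pdf.
  + by move=> E _ mE; rewrite -Radon_Nikodym_SigmaFinite.f_integral.
Qed.

(* With [u = x ^+ 2 / (8 s ^+ 2)] the bound reads [u * exp (- 4 u) <= exp (- u)]:
   it trades the second moment for the total mass of a wider Gaussian. *)
Lemma sqr_normal_pdf_le (s x : R) : 0 < s ->
  x ^+ 2 * normal_pdf 0 s x <= 16 * s ^+ 2 * normal_pdf 0 (2 * s) x.
Proof.
move=> s0; rewrite !normal_pdfE ?mulf_neq0 ?gt_eqF// /normal_peak /normal_fun.
have -> : Num.sqrt ((2 * s) ^+ 2 * pi *+ 2) = 2 * Num.sqrt (s ^+ 2 * pi *+ 2) :> R.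
  rewrite exprMn -mulrA -mulrnAr sqrtrM ?sqr_ge0// sqrtr_sqr ger0_norm//.
set pk := Num.sqrt _; rewrite subr0 invfM.
set u := x ^+ 2 / (8 * s ^+ 2).
have s20 : s ^+ 2 != 0 by rewrite expf_neq0// gt_eqF.
have xE : x ^+ 2 = 8 * s ^+ 2 * u by rewrite /u; field; rewrite gt_eqF.
have -> : - x ^+ 2 / (s ^+ 2 *+ 2) = - (4 * u).
  by rewrite /u -mulr_natr; field; rewrite gt_eqF.
have -> : - x ^+ 2 / ((2 * s) ^+ 2 *+ 2) = - u.
  by rewrite /u -mulr_natr; field; rewrite gt_eqF.
have u0 : 0 <= u by rewrite divr_ge0 ?sqr_ge0// mulr_ge0// sqr_ge0.
have ue : u * expR (- (4 * u)) <= expR (- u).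
  rewrite (_ : - (4 * u) = - u + - (3 * u)); last by ring.
  rewrite expRD mulrCA ler_piMr ?expR_ge0// expRN.
  rewrite ler_pdivrMr ?expR_gt0// mul1r (le_trans _ (expR_ge1Dx _))//; lra.
rewrite xE.
have pk0 : 0 <= pk^-1 by rewrite invr_ge0 sqrtr_ge0.
have := ler_wpM2l (mulr_ge0 (sqr_ge0 s) pk0) ue.
nra.
Qed.

(** The wider Gaussian has mass one, which leaves the factor: 8 from the scale of the exponent and 2
    from the ratio of the two peaks. Only the order [s ^+ 2] matters later: it bounds the second
    moment of a Brownian increment by a multiple of its length. *)
Lemma normal_prob_sqr_le (s : R) : 0 < s ->
  (\int[normal_prob 0 s]_x (x ^+ 2)%:E <= (16 * s ^+ 2)%:E)%E.
Proof.
move=> s0; rewrite ge0_integral_normal_prob//; last 2 first.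
- by apply/measurable_EFinP; exact: measurable_funX.
- by move=> x; rewrite lee_fin sqr_ge0.
apply: (@le_trans _ _
    (\int[mu]_x ((16 * s ^+ 2)%:E * (normal_pdf 0 (2 * s) x)%:E)))%E.
  apply: ge0_le_integral => //.
  - by move=> x _; rewrite lee_fin mulr_ge0 ?sqr_ge0 ?normal_pdf_ge0.
  - apply/measurable_EFinP/measurable_funM; first exact: measurable_funX.
    exact: measurable_normal_pdf.
  - by apply/measurable_EFinP/measurable_funM => //; exact: measurable_normal_pdf.
  - by move=> x _; rewrite lee_fin sqr_normal_pdf_le.
rewrite integralZl//; last exact: integrable_normal_pdf.
by rewrite integral_normal_pdf mule1.
Qed.

Let measurable_opp : measurable_fun setT (-%R : measurableTypeR R -> measurableTypeR R).
Proof. exact: oppr_measurable. Qed.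

Lemma normal_prob_opp (s : R) (A : set (measurableTypeR R)) :
  s != 0 -> measurable A ->
  normal_prob 0 s (-%R @^-1` A) = normal_prob 0 s A.
Proof.
move=> s0 mA; rewrite /normal_prob.
transitivity (\int[mu]_(x in -%R @^-1` A)
    ((fun y => (normal_pdf 0 s y)%:E) \o (-%R)) x)%E.
  by apply: eq_integral => x _ /=; rewrite !normal_pdfE// /normal_fun !subr0 sqrrN.
rewrite -(ge0_integral_pushforward measurable_opp)//=; last 2 first.
- by apply/measurable_EFinP/measurable_funTS; exact: measurable_normal_pdf.
- by move=> x _; rewrite lee_fin normal_pdf_ge0.
by apply: eq_measure_integral => B mB _; rewrite /= lebesgue_measureN.
Qed.

Lemma integrable_normal_prob_id (s : R) : 0 < s ->
  (normal_prob 0 s).-integrable setT (EFin : measurableTypeR R -> \bar R).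
Proof.
move=> s0; apply/integrableP; split; first exact: EFin_measurable.
apply: (@le_lt_trans _ _ (\int[normal_prob 0 s]_x (1 + (x ^+ 2)%:E)))%E.
  apply: ge0_le_integral => //.
  - by apply: measurableT_comp => //; exact: EFin_measurable.
  - by apply: emeasurable_funD => //; apply/measurable_EFinP; exact: measurable_funX.
  - move=> x _; rewrite lee_fin.
    have := sqr_ge0 (`|x| - 1); have := normr_ge0 x.
    by rewrite -(real_normK (num_real x)); nra.
rewrite ge0_integralD//; last 2 first.
- by move=> x _; rewrite lee_fin sqr_ge0.
- by apply/measurable_EFinP; exact: measurable_funX.
rewrite integral_cst//= probability_setT mule1 lte_add_pinfty ?ltry//.
by apply: le_lt_trans (normal_prob_sqr_le s0) _; rewrite ltry.
Qed.

(** By symmetry the integral equals its own opposite, and being finite it must vanish. *)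
Lemma integral_normal_prob_id (s : R) : 0 < s ->
  (\int[normal_prob 0 s]_(x in [set: measurableTypeR R]) x%:E = 0)%E.
Proof.
move=> s0; have iid := integrable_normal_prob_id s0.
suff : (\int[normal_prob 0 s]_(x in [set: measurableTypeR R]) x%:E =
       - \int[normal_prob 0 s]_(x in [set: measurableTypeR R]) x%:E)%E.
  have /fineK <- := integrable_fin_num measurableT iid.
  by move=> [] /eqP; rewrite -subr_eq0 opprK -mulr2n mulrn_eq0/= => /eqP ->.
rewrite -integralN; last exact: integrable_add_def iid.
have iN : (normal_prob 0 s).-integrable setT
    ((EFin : measurableTypeR R -> \bar R) \o -%R).
  by have := integrableN iid; apply: eq_integrable.
have := integral_pushforward measurable_opp (@EFin_measurable R setT) iN measurableT.
rewrite preimage_setT => <-.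
by apply: eq_measure_integral => A mA _; rewrite /= /pushforward normal_prob_opp// gt_eqF.
Qed.

End normal_moments.

(** * Expectation of a product of independent variables *)

Section independent_product.
Context d (Omega : measurableType d) (R : realType) (P : probability Omega R).
Variables Z D : Omega -> R.
Hypotheses (mZ : measurable_fun setT Z) (mD : measurable_fun setT D).
Hypothesis indep : forall A B : set R, measurable A -> measurable B ->
  P (Z @^-1` A `&` D @^-1` B) = (P (Z @^-1` A) * P (D @^-1` B))%E.
Hypotheses (iZ : P.-integrable setT (EFin \o Z))
  (iD : P.-integrable setT (EFin \o D)).

Let Zm : {mfun Omega >-> R} := HB.pack Z (isMeasurableFun.Build _ _ _ _ Z mZ).
Let Dm : {mfun Omega >-> R} := HB.pack D (isMeasurableFun.Build _ _ _ _ D mD).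
Let ZD w := (Z w, D w).
Let mZD : measurable_fun setT ZD. Proof. exact: measurable_fun_pair. Qed.
Let ZDm : {mfun Omega >-> (R * R)%type} :=
  HB.pack ZD (isMeasurableFun.Build _ _ _ _ ZD mZD).

(** Independence says that the joint law and the product of the marginal laws agree on rectangles,
    and rectangles determine the product measure. *)
Let law_ZD (f : R * R -> \bar R) :
  (\int[distribution P ZDm]_z f z =
   \int[distribution P Zm \x distribution P Dm]_z f z)%E.
Proof.
apply: eq_measure_integral => A mA _.
by apply/esym; apply: product_measure_unique.
Qed.

Let mmul : measurable_fun setT (fun z : R * R => (z.1 * z.2)%:E).
Proof. by apply/measurable_EFinP; apply: measurable_funM. Qed.

Lemma integrable_indep_mul : P.-integrable setT (fun w => (Z w * D w)%:E).
Proof.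
apply/integrableP; split.
  by apply/measurable_EFinP; exact: measurable_funM.
rewrite -[ltLHS](@ge0_integral_distribution _ _ _ _ _ P ZDm
  (fun z => `|(z.1 * z.2)%:E|%E))//; last exact: measurableT_comp.
rewrite law_ZD fubini_tonelli1//; last exact: measurableT_comp.
rewrite /fubini_F/=.
under eq_integral => x _.
  under eq_integral do rewrite normrM EFinM.
  rewrite ge0_integralZl//; last by apply/measurable_EFinP; exact: normr_measurable.
  over.
have finD : (\int[distribution P Dm]_y `|y|%:E < +oo)%E.
  rewrite ge0_integral_distribution//; last by apply/measurable_EFinP; exact: normr_measurable.
  by have /integrableP[] := iD.
have finZ : (\int[distribution P Zm]_y `|y|%:E < +oo)%E.
  rewrite ge0_integral_distribution//; last by apply/measurable_EFinP; exact: normr_measurable.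
  by have /integrableP[] := iZ.
have nabs0 (Y : {mfun Omega >-> R}) :
  (0 <= \int[distribution P Y]_y `|y|%:E)%E.
  by apply: integral_ge0 => y _; rewrite lee_fin.
rewrite ge0_integralZr//; [|by apply/measurable_EFinP; exact: normr_measurable|exact: nabs0].
by apply: lte_mul_pinfty => //; rewrite ?ge0_fin_numE//; exact: nabs0.
Qed.

Lemma integral_indep_mul :
  (\int[P]_w (Z w * D w)%:E = \int[P]_w (Z w)%:E * \int[P]_w (D w)%:E)%E.
Proof.
have iZD := integrable_indep_mul.
rewrite -[LHS](@integral_distribution _ _ _ _ _ P ZDm
  (fun z => (z.1 * z.2)%:E))//.
have iprod : (distribution P Zm \x distribution P Dm)%E.-integrable setT
    (fun z : R * R => (z.1 * z.2)%:E).
  apply/integrableP; split => //.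
  rewrite -law_ZD ge0_integral_distribution//; last exact: measurableT_comp.
  by have /integrableP[] := iZD.
rewrite law_ZD -integral12_prod_meas1// /fubini_F/=.
have idD : (distribution P Dm).-integrable setT EFin.
  by apply: integrable_pushforward.
have idZ : (distribution P Zm).-integrable setT EFin.
  by apply: integrable_pushforward.
under eq_integral => x _.
  under eq_integral do rewrite EFinM.
  rewrite integralZl// integral_distribution//.
  over.
rewrite /=.
have /fineK <- := integrable_fin_num measurableT iD.
by rewrite integralZr// integral_distribution.
Qed.

End independent_product.

(** * Brownian increments and the augmented filtration *)

Lemma measure_eq_off_null d (T : measurableType d) (R : realType)
    (mu : {measure set T -> \bar R}) (A B N : set T) :
  measurable A -> measurable B -> measurable N -> mu N = 0%E ->
  (forall x, ~ N x -> (A x <-> B x)) -> mu A = mu B.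
Proof.
move=> mA mB mN N0 AB.
rewrite -(measureU0 mA mN N0) -(measureU0 mB mN N0); congr (mu _).
apply/seteqP; split => x; have [Nx|Nx] := pselect (N x); try by right.
  by case=> // /(AB _ Nx); left.
by case=> // /(AB _ Nx); left.
Qed.

Section measurable_wrt_theory.
Context (R : realType) (Omega : Type).
Implicit Types (G : set (set Omega)) (Y : Omega -> R).

Lemma measurable_wrtP G Y : measurable_wrt G Y <->
  (forall B : set R, measurable B -> G (Y @^-1` B)).
Proof.
split=> [GY B mB|GY A [B mB <-]]; last by rewrite setTI; exact: GY.
by apply: GY; exists B => //; rewrite setTI.
Qed.

Lemma sub_measurable_wrt G G' Y :
  G `<=` G' -> measurable_wrt G Y -> measurable_wrt G' Y.
Proof. by move=> GG' GY A /GY /GG'. Qed.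

End measurable_wrt_theory.

Lemma measurable_wrt_measurable d (Omega : measurableType d) (R : realType)
    (Y : Omega -> R) :
  measurable_wrt measurable Y <-> measurable_fun setT Y.
Proof.
split=> [/measurable_wrtP mY _ B mB|mY]; first by rewrite setTI; exact: mY.
by apply/measurable_wrtP => B mB; rewrite -[_ @^-1` _]setTI; exact: mY.
Qed.

(* Measurability with respect to a sub-sigma-algebra is measurability on the
   type [g_sigma_algebraType], for which the closure lemmas are available. *)
Lemma measurable_wrt_g_sigma (R : realType) (Omega : pointedType)
    (G : set (set Omega)) (Y : Omega -> R) :
  measurable_wrt <<s G >> Y <->
  measurable_fun setT (Y : g_sigma_algebraType G -> R).
Proof. exact: (@measurable_wrt_measurable _ (g_sigma_algebraType G)). Qed.

Section brownian.
Context d (Omega : measurableType d) (R : realType) (P : probability Omega R).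
Context (m : nat) (W : 'I_m -> R -> Omega -> R).
Hypothesis bmW : brownian_motion P W.
Local Notation F := (augmented_filtration P W).
Implicit Types (s t u : R) (l : 'I_m).

Lemma natural_filtration_measurable t : natural_filtration W t `<=` measurable.
Proof.
apply: smallest_sub; first exact: sigma_algebra_measurable.
move=> A [l [u [/andP[u0 _] [B mB <-]]]].
by apply: (bm_measurable bmW).
Qed.

Lemma augmented_filtration_measurable t : F t `<=` measurable.
Proof.
apply: smallest_sub; first exact: sigma_algebra_measurable.
by move=> A [/natural_filtration_measurable|[]].
Qed.

Lemma natural_filtration_le s t : s <= t ->
  natural_filtration W s `<=` natural_filtration W t.
Proof.
move=> st; apply: sub_sigma_algebra2.
move=> A [l [u [/andP[u0 us] WA]]].
by exists l, u; split => //; rewrite u0 (le_trans us st).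
Qed.

Lemma augmented_filtration_le s t : s <= t -> F s `<=` F t.
Proof.
move=> st; apply: sub_sigma_algebra2.
move=> A [/(natural_filtration_le st) sA|nA].
  by left.
by right.
Qed.

Lemma brownian_adapted l t : 0 <= t -> measurable_wrt (F t) (W l t).
Proof.
move=> t0; apply/measurable_wrtP => B mB; apply: sub_sigma_algebra; left.
apply: sub_sigma_algebra; exists l, t; rewrite t0 lexx; split => //.
by exists B => //; rewrite setTI.
Qed.

(** [bm_independent] speaks of the natural filtration, whereas the integrands are adapted to the
    augmented one. The sets that agree with an event of the natural filtration off a null set form a
    sigma-algebra containing both kinds of generators. *)
Lemma augmented_filtration_ae t A : F t A ->
  exists A' N, [/\ natural_filtration W t A', measurable N, P N = 0%E &
    forall w, ~ N w -> (A w <-> A' w)].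
Proof.
move: A; change (F t `<=` [set A | exists A' N, [/\ natural_filtration W t A',
  measurable N, P N = 0%E & forall w, ~ N w -> (A w <-> A' w)]]).
apply: smallest_sub => /=; last first.
  move=> A [tA|[mA A0]]; first by exists A, set0; split => //; exact: measure0.
  exists set0, A; split => //; exact: sigma_algebra0.
split.
- exists set0, set0; split => //; exact: sigma_algebra0.
- move=> A [A' [N [tA' mN N0 AA']]]; exists (setT `\` A'), N; split => //.
    exact: sigma_algebraCD.
  by move=> w /AA' [a b]; split => -[_ ?]; split => //; [move/b|move/a].
(* One event and one null set are chosen for each [n]; the union of these countably many null sets
   is again null. *)
- move=> A hA; have /choice [f fP] : forall n, exists AN : set Omega * set Omega,
      [/\ natural_filtration W t AN.1, measurable AN.2, P AN.2 = 0%E &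
       forall w, ~ AN.2 w -> (A n w <-> AN.1 w)].
    by move=> n; have [A' [N ?]] := hA n; exists (A', N).
  exists (\bigcup_n (f n).1), (\bigcup_n (f n).2); split.
  + by apply: sigma_algebra_bigcup => n; case: (fP n).
  + by apply: bigcup_measurable => n _; case: (fP n).
  + have mf n : measurable (f n).2 by case: (fP n).
    apply: (@negligibleP _ _ _ P _ (bigcup_measurable (fun n _ => mf n))).1.
    apply: negligible_bigcup => n; apply: (@negligibleP _ _ _ P _ (mf n)).2.
    by case: (fP n).
  + move=> w Nw; have An n : A n w <-> (f n).1 w.
      by case: (fP n) => _ _ _; apply => Nn; apply: Nw; exists n.
    by split => -[n _ /An ?]; exists n.
Qed.

Lemma brownian_increment_measurable l s t : 0 <= s -> 0 <= t ->
  measurable_fun setT (fun w => W l t w - W l s w).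
Proof. by move=> s0 t0; apply: measurable_funB; exact: (bm_measurable bmW). Qed.

Lemma brownian_increment_indep l s t (A : set Omega) (B : set R) :
  0 <= s -> s < t -> F s A -> measurable B ->
  P (A `&` (fun w => W l t w - W l s w) @^-1` B) =
  (P A * P ((fun w => W l t w - W l s w)%R @^-1` B))%E.
Proof.
move=> s0 st FA mB; have t0 := ltW (le_lt_trans s0 st).
have [A' [N [nA' mN N0 AA']]] := augmented_filtration_ae FA.
have mA := augmented_filtration_measurable FA.
have mA' := natural_filtration_measurable nA'.
have mD : measurable ((fun w => W l t w - W l s w) @^-1` B).
  by rewrite -[X in measurable X]setTI; apply: brownian_increment_measurable.
rewrite (measure_eq_off_null mA mA' mN N0 AA').
have -> : P (A `&` (fun w => W l t w - W l s w) @^-1` B) =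
    P (A' `&` (fun w => W l t w - W l s w) @^-1` B).
  apply: measure_eq_off_null N0 _ => //; [exact: measurableI..|].
  by move=> w /AA' [a b]; split => -[? ?]; split => //; [exact: a|exact: b].
have st0 : 0 <= s < t by rewrite s0.
(* Independence is given for all components jointly; leaving the other components unconstrained
   isolates the [l]-th one. *)
pose B' l' : set R := if l' == l then B else setT.
have mB' l' : measurable (B' l') by rewrite /B'; case: ifP.
have := bm_independent bmW st0 nA' mB'.
rewrite (bigD1 l)//= big1; last first.
  move=> i /negbTE il; rewrite /B' il.
  by rewrite (_ : [set w | _] = setT) ?probability_setT//; apply/seteqP; split.
rewrite mule1 /B' eqxx => <-; congr (P (_ `&` _)).
apply/seteqP; split => w /=; last by move=> /(_ l); rewrite eqxx.
by move=> Bw l'; case: eqP => // ->.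
Qed.

Section increment_moments.
Variables (l : 'I_m) (s t : R).
Hypotheses (s0 : 0 <= s) (st : s < t).
Let t0 : 0 <= t. Proof. exact: ltW (le_lt_trans s0 st). Qed.
Let D w : measurableTypeR R := W l t w - W l s w.
Let mD : measurable_fun setT D. Proof. exact: brownian_increment_measurable. Qed.
Let Dm : {mfun Omega >-> measurableTypeR R} :=
  HB.pack D (isMeasurableFun.Build _ _ _ _ D mD).
Let sd := Num.sqrt (t - s).
Let sd_gt0 : 0 < sd. Proof. by rewrite sqrtr_gt0 subr_gt0. Qed.

Let law_D (f : measurableTypeR R -> \bar R) :
  (\int[distribution P Dm]_z f z = \int[normal_prob 0 sd]_z f z)%E.
Proof.
apply: eq_measure_integral => A mA _.
by rewrite /distribution /pushforward/= -(@bm_gaussian _ _ _ _ _ _ bmW l s t)// s0.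
Qed.

Lemma brownian_increment_integrable :
  P.-integrable setT (fun w => (W l t w - W l s w)%:E).
Proof.
apply/integrableP; split.
  by apply/measurable_EFinP; exact: brownian_increment_measurable.
have mabs : measurable_fun [set: measurableTypeR R]
    (fun x : measurableTypeR R => `|x%:E|%E).
  by apply: measurableT_comp => //; exact: EFin_measurable.
rewrite -[ltLHS](@ge0_integral_distribution _ _ _ _ _ P Dm
  (fun x => `|x%:E|%E))// law_D.
by have /integrableP[] := integrable_normal_prob_id sd_gt0.
Qed.

Lemma brownian_increment_mean : (\int[P]_w (W l t w - W l s w)%:E = 0)%E.
Proof.
rewrite -(integral_normal_prob_id sd_gt0) -law_D.
rewrite (@integral_distribution _ _ _ _ _ P Dm EFin)//.
exact: brownian_increment_integrable.
Qed.

Lemma brownian_increment_sqr :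
  (\int[P]_w ((W l t w - W l s w) ^+ 2)%:E <= (16 * (t - s))%:E)%E.
Proof.
rewrite -[leLHS](@ge0_integral_distribution _ _ _ _ _ P Dm
  (fun x => (x ^+ 2)%:E))//; last 2 first.
- by apply/measurable_EFinP; exact: measurable_funX.
- by move=> x; rewrite lee_fin sqr_ge0.
rewrite law_D; apply: le_trans (normal_prob_sqr_le sd_gt0) _.
by rewrite sqr_sqrtr// subr_ge0 ltW.
Qed.

End increment_moments.

End brownian.

(** * Simple and Itô integrals *)

Section square_integrable.
Context d (Omega : measurableType d) (R : realType) (P : probability Omega R).
Implicit Types Y Z : Omega -> R.

Definition sqr_integrable Y := measurable_fun setT Y /\
  P.-integrable setT (fun w => (Y w ^+ 2)%:E).

Lemma sqr_integrableM Y Z : sqr_integrable Y -> sqr_integrable Z ->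
  P.-integrable setT (fun w => (Y w * Z w)%:E).
Proof.
move=> [mY iY] [mZ iZ]; have := integrableD measurableT iY iZ.
apply: le_integrable => //.
  by apply/measurable_EFinP; exact: measurable_funM.
move=> w _ /=; rewrite lee_fin [leRHS]ger0_norm ?addr_ge0 ?sqr_ge0// normrM.
rewrite -(real_normK (num_real (Y w))) -(real_normK (num_real (Z w))).
have := sqr_ge0 (`|Y w| - `|Z w|); have := normr_ge0 (Y w); have := normr_ge0 (Z w); nra.
Qed.

Lemma bounded_sqr_integrable Y K : measurable_fun setT Y ->
  (forall w, `|Y w| <= K) -> sqr_integrable Y.
Proof.
move=> mY YK; split => //; apply: measurable_bounded_integrable => //.
- by rewrite [ltLHS]probability_setT ltry.
- exact: measurable_funX.
- exists (K ^+ 2); split; first exact: num_real.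
  move=> x Kx w _; apply: le_trans (ltW Kx).
  rewrite [leLHS](normrX 2 (Y w)) ler_pXn2r ?nnegrE//.
  exact: le_trans (YK w).
Qed.

Lemma sqr_integrable_integrable Y : sqr_integrable Y ->
  P.-integrable setT (EFin \o Y).
Proof.
move=> iY; have i1 : sqr_integrable (cst 1).
  by apply: (@bounded_sqr_integrable _ 1) => // w; rewrite normr1.
by have := sqr_integrableM iY i1; apply: eq_integrable => // w _ /=; rewrite mulr1.
Qed.

Lemma sqr_integrableD Y Z : sqr_integrable Y -> sqr_integrable Z ->
  sqr_integrable (fun w => Y w + Z w).
Proof.
move=> iY iZ; split; first by apply: measurable_funD; [case: iY|case: iZ].
have := integrableD measurableT
  (integrableD measurableT iY.2 (integrableZl measurableT 2 (sqr_integrableM iY iZ))) iZ.2.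
by apply: eq_integrable => // w _ /=; rewrite -EFinM -!EFinD; congr EFin; ring.
Qed.

Lemma integral_sqrD Y Z : sqr_integrable Y -> sqr_integrable Z ->
  (\int[P]_w ((Y w + Z w) ^+ 2)%:E = \int[P]_w (Y w ^+ 2)%:E +
    2%:E * \int[P]_w (Y w * Z w)%:E + \int[P]_w (Z w ^+ 2)%:E)%E.
Proof.
move=> iY iZ; have iYZ := sqr_integrableM iY iZ.
rewrite -integralZl// -integralD//; [|exact: iY.2|exact: integrableZl].
rewrite -integralD//; [|exact: integrableD iY.2 (integrableZl _ 2 iYZ)|exact: iZ.2].
by apply: eq_integral => w _; rewrite -EFinM -!EFinD; congr EFin; ring.
Qed.

End square_integrable.

(** No measurability is assumed: a non-negative integral is a supremum over the simple functions
    below the integrand. This allows comparison with inner time integrals whose measurability in [w]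
    has not been established. *)
Lemma ge0_le_integralT d (T : measurableType d) (R : realType)
    (mu : {measure set T -> \bar R}) (f g : T -> \bar R) :
  (forall x, 0 <= f x)%E -> (forall x, f x <= g x)%E ->
  (\int[mu]_x f x <= \int[mu]_x g x)%E.
Proof.
move=> f0 fg; rewrite !ge0_integralTE//; last by move=> x; exact: le_trans (fg x).
apply: le_ereal_sup => _ [h hf <-]; exists h => // x.
exact: le_trans (hf x) (fg x).
Qed.

Lemma sqr_le_sub (R : realFieldType) (x y k : R) :
  y ^+ 2 <= k -> x ^+ 2 <= 2 * (x - y) ^+ 2 + 2 * k.
Proof. by move=> yk; have := sqr_ge0 (x - 2 * y); nra. Qed.

Lemma normr_le_sqrD (R : realFieldType) (x y : R) :
  `|y| <= 1 + ((x - y) ^+ 2 + x ^+ 2).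
Proof.
have : `|y| <= `|x - y| + `|x| by rewrite distrC -{1}(subrK x y) ler_normD.
rewrite -(real_normK (num_real (x - y))) -(real_normK (num_real x)).
have := sqr_ge0 (`|x - y| - 1); have := sqr_ge0 (`|x| - 1); nra.
Qed.

(** A substitute for the Cauchy-Schwarz inequality: once integrated, a second moment of at most
    [e ^+ 2] gives a first moment of at most [e]. *)
Lemma normr_le_half_sqr (R : realFieldType) (x e : R) : 0 < e ->
  `|x| <= e / 2 + (2 * e)^-1 * x ^+ 2.
Proof.
move=> e0; rewrite -(real_normK (num_real x)) -(ler_pM2l (mulr_gt0 (ltr0n _ 2) e0)).
rewrite mulrDr mulVKf ?mulf_neq0 ?gt_eqF//.
have := sqr_ge0 (`|x| - e); nra.
Qed.

Section ito_moments.
Context d (Omega : measurableType d) (R : realType) (P : probability Omega R).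
Context (m : nat) (W : 'I_m -> R -> Omega -> R).
Hypothesis bmW : brownian_motion P W.
Local Notation F := (augmented_filtration P W).

Lemma augmented_measurable_fun t (Y : Omega -> R) :
  measurable_wrt (F t) Y -> measurable_fun setT Y.
Proof.
move=> mY; apply/measurable_wrt_measurable.
exact: sub_measurable_wrt (augmented_filtration_measurable bmW (t := t)) mY.
Qed.

Lemma brownian_increment_sqr_integrable l s t : 0 <= s -> s < t ->
  sqr_integrable P (fun w => W l t w - W l s w).
Proof.
move=> s0 st; have mD := brownian_increment_measurable bmW l s0 (ltW (le_lt_trans s0 st)).
split => //; apply/integrableP; split.
  by apply/measurable_EFinP; exact: measurable_funX.
under eq_integral do rewrite gee0_abs ?lee_fin ?sqr_ge0//.
exact: le_lt_trans (brownian_increment_sqr bmW l s0 st) (ltry _).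
Qed.

Section increment_step.
Variables (l : 'I_m) (s t : R).
Hypotheses (s0 : 0 <= s) (st : s < t).
Let D w := W l t w - W l s w.
Let iD : sqr_integrable P D. Proof. exact: brownian_increment_sqr_integrable. Qed.

Lemma adapted_mul_increment (Z : Omega -> R) : measurable_wrt (F s) Z ->
  P.-integrable setT (EFin \o Z) ->
  P.-integrable setT (fun w => (Z w * D w)%:E) /\
  (\int[P]_w (Z w * D w)%:E = 0)%E.
Proof.
move=> aZ iZ; have mZ := augmented_measurable_fun aZ.
have idp (A B : set R) : measurable A -> measurable B ->
    P (Z @^-1` A `&` D @^-1` B) = (P (Z @^-1` A) * P (D @^-1` B))%E.
  move=> mA mB; apply: brownian_increment_indep => //.
  by move/measurable_wrtP: aZ; apply.
have iD1 := sqr_integrable_integrable iD.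
split; first exact: integrable_indep_mul mZ iD.1 idp iZ iD1.
rewrite (integral_indep_mul mZ iD.1 idp iZ iD1).
by rewrite (brownian_increment_mean bmW l s0 st) mule0.
Qed.

Lemma adapted_mul_increment_sqr (Z : Omega -> R) : measurable_wrt (F s) Z ->
  sqr_integrable P Z ->
  sqr_integrable P (fun w => Z w * D w) /\
  (\int[P]_w ((Z w * D w) ^+ 2)%:E <=
    (16 * (t - s))%:E * \int[P]_w (Z w ^+ 2)%:E)%E.
Proof.
move=> aZ [mZ iZ].
have idp (A B : set R) : measurable A -> measurable B ->
    P ((fun w => Z w ^+ 2) @^-1` A `&` (fun w => D w ^+ 2) @^-1` B) =
    (P ((fun w => (Z w ^+ 2)%R) @^-1` A) * P ((fun w => (D w ^+ 2)%R) @^-1` B))%E.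
  move=> mA mB.
  have msqr (C : set R) : measurable C -> measurable ((fun x : R => x ^+ 2) @^-1` C).
    by move=> mC; rewrite -[X in measurable X]setTI; apply: measurable_funX.
  apply: (@brownian_increment_indep _ _ _ _ _ _ bmW l s t
    ((fun w => Z w ^+ 2) @^-1` A) ((fun x => x ^+ 2) @^-1` B)) => //.
  - by move/measurable_wrtP: aZ => /(_ _ (msqr _ mA)).
  - exact: msqr.
have mZ2 := measurable_funX 2 mZ; have mD2 := measurable_funX 2 iD.1.
split.
  split; first by apply: measurable_funM => //; exact: iD.1.
  have := integrable_indep_mul mZ2 mD2 idp iZ iD.2.
  by apply: eq_integrable => // w _; rewrite exprMn.
under eq_integral do rewrite exprMn.
rewrite (integral_indep_mul mZ2 mD2 idp iZ iD.2) muleC lee_wpmul2r//.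
  by apply: integral_ge0 => w _; rewrite lee_fin sqr_ge0.
exact: brownian_increment_sqr.
Qed.

(** The cross term of the square is [Y * v * D] with [Y * v] known at time [s], so it integrates to
    zero. Adaptedness of [Y'] at time [t] belongs to the conclusion so that the step can be
    iterated. *)
Lemma increment_step (Y v : Omega -> R) (K : R) :
  measurable_wrt (F s) Y -> sqr_integrable P Y ->
  measurable_wrt (F s) v -> (forall w, `|v w| <= K) ->
  let Y' w := Y w + v w * D w in
  [/\ measurable_wrt (F t) Y', sqr_integrable P Y',
    (\int[P]_w (Y' w)%:E = \int[P]_w (Y w)%:E)%E &
    (\int[P]_w (Y' w ^+ 2)%:E <= \int[P]_w (Y w ^+ 2)%:E +
      (16 * (t - s))%:E * \int[P]_w (v w ^+ 2)%:E)%E].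
Proof.
move=> aY iY av vK Y'.
have iv := bounded_sqr_integrable P (augmented_measurable_fun av) vK.
have [ivD vD2] := adapted_mul_increment_sqr av iv.
have aYv : measurable_wrt (F s) (fun w => Y w * v w).
  move/measurable_wrt_g_sigma: aY => aY; move/measurable_wrt_g_sigma: av => av.
  by apply/measurable_wrt_g_sigma; exact: measurable_funM.
have [iYvD YvD0] := adapted_mul_increment aYv (sqr_integrableM iY iv).
split.
- have t0 := ltW (le_lt_trans s0 st).
  have F_st := augmented_filtration_le (P := P) (W := W) (ltW st).
  have /measurable_wrt_g_sigma aY' := sub_measurable_wrt F_st aY.
  have /measurable_wrt_g_sigma av' := sub_measurable_wrt F_st av.
  have /measurable_wrt_g_sigma Wt : measurable_wrt (F t) (W l t) by exact: brownian_adapted.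
  have /measurable_wrt_g_sigma Ws : measurable_wrt (F t) (W l s).
    by apply: sub_measurable_wrt F_st _; exact: brownian_adapted.
  apply/measurable_wrt_g_sigma; apply: measurable_funD => //.
  by apply: measurable_funM => //; exact: measurable_funB.
- exact: sqr_integrableD.
- under eq_integral do rewrite EFinD.
  rewrite integralD//; [|exact: sqr_integrable_integrable..].
  rewrite (adapted_mul_increment av (sqr_integrable_integrable iv)).2.
  by rewrite adde0.
- rewrite integral_sqrD//.
  rewrite (_ : (fun w => (Y w * (v w * D w))%:E) = fun w => (Y w * v w * D w)%:E).
    by rewrite YvD0 mule0 adde0 leeD2l.
  by apply/funext => w; rewrite mulrA.
Qed.

End increment_step.

(** * Moments of simple integrals *)

Section simple_integral_moments.
Variables (S : simple_process F) (l : 'I_m) (t : R).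
Hypothesis t0 : 0 <= t.
Let a i := Num.min (sp_time S i) t.
Let v := sp_value S.
Let SI n w := \sum_(i < n) v i w * (W l (a i.+1) w - W l (a i) w).

Let a_ge0 i : 0 <= a i.
Proof.
rewrite le_min t0 andbT (le_trans (sp_time_ge0 S))//.
exact: sp_time_nondecreasing.
Qed.

Let a_le i : a i <= a i.+1.
Proof.
by rewrite le_min !ge_min lexx orbT andbT (sp_time_nondecreasing S (leqnSn i)).
Qed.

Let iv2 i : sqr_integrable P (v i).
Proof.
have [K vK] := sp_value_bounded S i.
have mv := augmented_measurable_fun (@sp_value_adapted _ _ _ S i).
exact (bounded_sqr_integrable P mv vK).
Qed.

Let SI_moments n : [/\ measurable_wrt (F (a n)) (SI n), sqr_integrable P (SI n),
  (\int[P]_w (SI n w)%:E = 0)%E &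
  (\int[P]_w (SI n w ^+ 2)%:E <=
   \sum_(i < n) (16 * (a i.+1 - a i))%:E * \int[P]_w (v i w ^+ 2)%:E)%E].
Proof.
elim: n => [|n [aS iS S0 S2]].
  have SI0 : SI 0 = cst 0 by apply/funext => w; rewrite /SI big_ord0.
  rewrite SI0; split.
  - by apply/measurable_wrt_g_sigma; exact: measurable_cst.
  - by apply: (@bounded_sqr_integrable _ _ _ _ _ 0) => // w; rewrite normr0.
  - by rewrite integral0.
  - by rewrite big_ord0; under eq_integral do rewrite /= expr0n/=; rewrite integral0.
have SIS : SI n.+1 = fun w => SI n w + v n w * (W l (a n.+1) w - W l (a n) w).
  by apply/funext => w; rewrite /SI big_ord_recr.
have := a_le n; rewrite le_eqVlt => /orP[/eqP an|an].
  have -> : SI n.+1 = SI n.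
    by rewrite SIS; apply/funext => w; rewrite -an subrr mulr0 addr0.
  by rewrite big_ord_recr/= -an subrr mulr0 mul0e adde0.
rewrite SIS big_ord_recr/=.
(* A non-degenerate step starts before [t], so truncation leaves its left end unchanged. This is
   needed because [v n] is adapted at [sp_time S n], which may exceed [a n] when the truncated
   interval is empty. *)
have anE : a n = sp_time S n.
  apply/min_idPl; rewrite leNgt; apply/negP => tn; move: an.
  have -> : a n = t by apply/min_idPr/ltW.
  by rewrite ltNge ge_min lexx orbT.
have [K vK] := sp_value_bounded S n.
have av : measurable_wrt (F (a n)) (v n) by rewrite anE; exact: sp_value_adapted.
have [? ? e le2] := increment_step l (a_ge0 n) an aS iS av vK; split => //.
  by rewrite e.
by apply: le_trans le2 _; rewrite leeD2r.
Qed.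

Lemma simple_integral_sqr_integrable :
  sqr_integrable P (simple_integral S (W l) t).
Proof. by case: (SI_moments (sp_size S)). Qed.

Lemma simple_integral_mean : (\int[P]_w (simple_integral S (W l) t w)%:E = 0)%E.
Proof. by case: (SI_moments (sp_size S)). Qed.

(** The half-open intervals are pairwise disjoint, so the cross terms of the square vanish. *)
Let simple_eval_sqr s w : simple_eval S s w ^+ 2 =
  \sum_(i < sp_size S) v i w ^+ 2 * \1_(`]sp_time S i, sp_time S i.+1]) s.
Proof.
rewrite /simple_eval; elim: (sp_size S) => [|n IH].
  by rewrite !big_ord0 expr0n.
rewrite !big_ord_recr/= -IH [in RHS]indicE.
case: (boolP (s \in _)) => [|sn]; last by rewrite indicE (negbTE sn) !mulr0 !addr0.
rewrite inE/= in_itv/= => /andP[sn sn'].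
rewrite big1; last first.
  move=> i _; rewrite indicE memNset ?mulr0//= in_itv/=.
  have := sp_time_nondecreasing S (ltn_ord i) => le_in.
  by apply/negP; rewrite negb_and orbC -ltNge (le_lt_trans le_in).
by rewrite !add0r indicE mem_set/= ?in_itv/= ?sn ?sn'// !mulr1 expr0n add0r.
Qed.

Let simple_eval_sqr_integral w :
  (\int[lebesgue_measure]_(s in `[0%R, t]) ((simple_eval S s w) ^+ 2)%:E =
   \sum_(i < sp_size S) (a i.+1 - a i)%:E * (v i w ^+ 2)%:E)%E.
Proof.
under eq_integral do rewrite simple_eval_sqr -sumEFin.
rewrite ge0_integral_sum//; last 2 first.
- move=> i; apply/measurable_EFinP/measurable_funM => //.
- by move=> i s _; rewrite lee_fin mulr_ge0 ?sqr_ge0.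
apply: eq_bigr => i _.
under eq_integral do rewrite EFinM.
rewrite ge0_integralZl//; last by rewrite lee_fin sqr_ge0.
  rewrite muleC; congr (_ * _)%E.
  rewrite integral_indic// setIC.
  have -> : `[0, t] `&` `]sp_time S i, sp_time S i.+1] = `]a i, a i.+1]%classic.
    apply/seteqP; split => s /=; rewrite !in_itv/= /a.
      move=> [/andP[s0 st] /andP[ls sr]]; rewrite le_min sr st andbT gt_min.
      by rewrite ls.
    move=> /andP[]; rewrite gt_min le_min => + /andP[-> st].
    rewrite st andbT; case/orP => [ls|]; last by rewrite ltNge st.
    rewrite ls andbT; split => //.
    rewrite ltW// (le_lt_trans _ ls)// (le_trans (sp_time_ge0 S))//.
    exact: sp_time_nondecreasing.
  rewrite [LHS](lebesgue_measure_itv `]a i, a i.+1])/= lte_fin.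
  by have := a_le i; rewrite le_eqVlt => /orP[/eqP ->|->//]; rewrite ltxx subrr.
by apply/measurable_EFinP/measurable_funTS; exact: measurable_indic.
Qed.

Lemma simple_eval_sqr_integral_measurable : exists q : Omega -> R,
  measurable_fun setT q /\ forall w,
  (\int[lebesgue_measure]_(s in `[0%R, t]) ((simple_eval S s w) ^+ 2)%:E =
   (q w)%:E)%E.
Proof.
exists (fun w => \sum_(i < sp_size S) (a i.+1 - a i) * v i w ^+ 2); split.
  apply: measurable_sum => i; apply: measurable_funM => //.
  by apply: measurable_funX; case: (iv2 i).
by move=> w; rewrite simple_eval_sqr_integral -sumEFin; apply: eq_bigr.
Qed.

Lemma simple_eval_measurable w : measurable_fun setT (fun s => simple_eval S s w).
Proof. by apply: measurable_sum => i; exact: measurable_funM. Qed.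

(** Itô's isometry for simple integrands, weakened to an inequality by the factor 16 of the Gaussian
    estimate. *)
Lemma simple_integral_sqr_le :
  (\int[P]_w (simple_integral S (W l) t w ^+ 2)%:E <=
   16%:E * \int[P]_w \int[lebesgue_measure]_(s in `[0%R, t])
     ((simple_eval S s w) ^+ 2)%:E)%E.
Proof.
under [X in (_ * X)%E]eq_integral do rewrite simple_eval_sqr_integral.
rewrite ge0_integral_sum//; last 2 first.
- move=> i; apply: emeasurable_funM => //.
  by apply/measurable_EFinP; apply: measurable_funX; case: (iv2 i).
- by move=> i w _; rewrite mule_ge0 ?lee_fin ?sqr_ge0// subr_ge0.
have [_ _ _ /le_trans] := SI_moments (sp_size S); apply.
rewrite ge0_sume_distrr; last first.
  move=> i _; apply: integral_ge0 => w _.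
  by rewrite mule_ge0 ?lee_fin ?sqr_ge0// subr_ge0.
apply: lee_sum => i _; rewrite integralZl//; last by case: (iv2 i).
by rewrite muleA EFinM.
Qed.

End simple_integral_moments.

(** * Passage to the L^2 limit *)

Section ito_integral_moments.
Variables (l : 'I_m) (H : R -> Omega -> R) (t K : R) (I : Omega -> R).
Hypotheses (t0 : 0 <= t) (HK : forall s w, `|H s w| <= K).
Hypothesis itoI : is_ito_integral P F (W l) H t I.

Lemma ito_integral_measurable : measurable_fun setT I.
Proof. by case: itoI. Qed.

(** The two tolerances differ in purpose: distance 1 between the integrands is enough for a
    boundedness estimate, while the integrals must come arbitrarily close for the mean to vanish. *)
Let approx (e : R) : 0 < e -> exists S : simple_process F,
  (\int[P]_w \int[lebesgue_measure]_(s in `[0%R, t])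
     ((simple_eval S s w - H s w) ^+ 2)%:E <= 1)%E /\
  (\int[P]_w ((simple_integral S (W l) t w - I w) ^+ 2)%:E <= e%:E)%E.
Proof.
move=> e0; have [_ _ _ [S [S1 S2]]] := itoI.
have /fine_cvgP [fin1 /cvgrPdist_le /(_ _ ltr01) near1] := S1.
have /fine_cvgP [fin2 /cvgrPdist_le /(_ _ e0) near2] := S2.
near \oo => n; exists (S n); split.
- have fn1 : (\int[P]_w \int[lebesgue_measure]_(s in `[0%R, t])
    ((simple_eval (S n) s w - H s w) ^+ 2)%:E)%E \is a fin_num by near: n.
  rewrite -(fineK fn1) lee_fin.
  have : `|0 - fine (\int[P]_w \int[lebesgue_measure]_(s in `[0%R, t])
    ((simple_eval (S n) s w - H s w) ^+ 2)%:E)%E| <= 1 :> R by near: n.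
  by rewrite sub0r normrN; exact: le_trans (ler_norm _).
- have fn2 : ('E_P[fun w => ((simple_integral (S n) (W l) t w - I w) ^+ 2)%R]
    \is a fin_num)%E by near: n.
  move: (fn2); rewrite unlock => fn2'.
  rewrite -(fineK fn2') lee_fin.
  have : `|0 - fine 'E_P[fun w => ((simple_integral (S n) (W l) t w - I w) ^+ 2)%R]%E| <= e :> R
    by near: n.
  by rewrite unlock sub0r normrN; exact: le_trans (ler_norm _).
Unshelve. all: by end_near. Qed.

Let measurable_Hsection w : measurable_fun `[0, t] (H ^~ w).
Proof.
have [mH _ _ _] := itoI.
apply: (@measurable_comp _ _ _ _ _ _ (`[0, t] `*` setT)
  (fun z : R * Omega => H z.1 z.2) _ (fun s => (s, w))) mH _.
- exact: measurableX.
- by move=> _ [s st <-].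
- by apply: measurable_funTS; exact: pair2_measurable.
Qed.

(** The simple integrand is [H] plus an error of squared norm at most 1, and [H ^+ 2 <= K ^+ 2]; the
    inequality [(a + b)^2 <= 2 a^2 + 2 b^2] gives the bracket, and 16 comes from the weakened
    isometry. *)
Let simple_integral_bound (S : simple_process F) :
  (\int[P]_w \int[lebesgue_measure]_(s in `[0%R, t])
     ((simple_eval S s w - H s w) ^+ 2)%:E <= 1)%E ->
  (\int[P]_w (simple_integral S (W l) t w ^+ 2)%:E <=
   (16 * (2 + 2 * K ^+ 2 * t))%:E)%E.
Proof.
move=> S1; apply: le_trans (simple_integral_sqr_le S l t0) _.
rewrite EFinM lee_wpmul2l ?lee_fin//.
have [q [mq qE]] := simple_eval_sqr_integral_measurable S t.
under eq_integral do rewrite qE.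
set c := 2 * K ^+ 2 * t.
have c0 : 0 <= c by rewrite /c -mulrA mulr_ge0// mulr_ge0// sqr_ge0.
have K0 (w : Omega) : 0 <= K := le_trans (normr_ge0 _) (HK 0 w).
pose g w := (\int[lebesgue_measure]_(s in `[0%R, t])
  ((simple_eval S s w - H s w) ^+ 2)%:E)%E.
have mSH w : measurable_fun `[0, t] (fun s => simple_eval S s w - H s w).
  apply: measurable_funB; last exact: measurable_Hsection.
  by apply: measurable_funTS; exact: simple_eval_measurable.
have mSH2 w : measurable_fun `[0, t]
    (fun s : measurableTypeR R => ((simple_eval S s w - H s w) ^+ 2)%:E).
  by apply/measurable_EFinP; exact: (measurable_funX 2 (mSH w)).
have g0 w : (0 <= g w)%E by apply: integral_ge0 => s _; rewrite lee_fin sqr_ge0.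
have qg w : ((q w)%:E <= 2%:E * g w + c%:E)%E.
  have -> : c%:E = (\int[lebesgue_measure]_(s in `[0%R, t]) (2 * K ^+ 2)%:E)%E.
    rewrite integral_cst//= [X in (_ * X)%E](lebesgue_measure_itv `[0, t])/= lte_fin.
    rewrite /c EFinM; congr (_ * _)%E.
    by move: t0; rewrite le_eqVlt => /orP[/eqP <-|->]; rewrite ?ltxx// oppr0 adde0.
  rewrite -qE /g -ge0_integralZl//; last 2 first.
  - exact: mSH2.
  - by move=> s _; rewrite lee_fin sqr_ge0.
  rewrite -ge0_integralD//; last 3 first.
  - by move=> s _; rewrite mule_ge0// lee_fin sqr_ge0.
  - by apply: emeasurable_funM => //; exact: mSH2.
  - by move=> s _; rewrite lee_fin mulr_ge0// sqr_ge0.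
  apply: ge0_le_integral => //.
  - by move=> s _; rewrite lee_fin sqr_ge0.
  - apply/measurable_EFinP; apply: measurable_funTS.
    exact: (measurable_funX 2 (simple_eval_measurable S w)).
  - apply: emeasurable_funD => //; apply: emeasurable_funM => //.
    exact: mSH2.
  - move=> s _; rewrite -EFinM -EFinD lee_fin.
    have : H s w ^+ 2 <= K ^+ 2.
      by rewrite -(real_normK (num_real (H s w))) ler_pXn2r ?nnegrE ?(K0 w).
    exact: sqr_le_sub.
(* Splitting the integral of [2 g + c] would require [g] to be measurable in [w]. The function
   [max ((q - c) / 2) 0] is measurable, lies below [g] by [qg], and twice it plus [c] still
   dominates [q]. *)
have mh : measurable_fun setT (fun w => Num.max ((q w - c) / 2) 0).
  apply: measurable_maxr => //; apply: measurable_funM => //.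
  exact: measurable_funB.
apply: (@le_trans _ _ (\int[P]_w (c%:E + 2%:E * (Num.max ((q w - c) / 2) 0)%:E))%E).
  apply: ge0_le_integralT => w.
    by rewrite -qE integral_ge0// => s _; rewrite lee_fin sqr_ge0.
  rewrite -EFinM -EFinD lee_fin -lerBlDl -ler_pdivrMl// mulrC.
  by rewrite le_max lexx.
case: (pselect (exists w : Omega, True)) => [[w0 _]|noO]; last first.
  rewrite (_ : [set: Omega] = set0) ?integral_set0 ?lee_fin//.
    by rewrite addr_ge0.
  by apply/seteqP; split => w // _; exfalso; apply: noO; exists w.
rewrite ge0_integralD//; last 2 first.
- by move=> w _; rewrite -EFinM lee_fin mulr_ge0// le_max lexx orbT.
- by apply: emeasurable_funM => //; exact/measurable_EFinP.
rewrite integral_cst//= probability_setT mule1 ge0_integralZl//; last 2 first.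
- exact/measurable_EFinP.
- by move=> w _; rewrite lee_fin le_max lexx orbT.
rewrite (addrC 2 c) (EFinD c 2); apply: leeD2l.
rewrite -[leRHS]mule1; apply: lee_wpmul2l => //.
apply: le_trans S1; apply: ge0_le_integralT => w.
  by rewrite lee_fin le_max lexx orbT.
rewrite -/(g w); have := qg w; have := g0 w; case: (g w) => [r| |]//.
- rewrite -EFinM -EFinD !lee_fin => r0 qr; rewrite ge_max r0 andbT.
  by rewrite ler_pdivrMr// lerBlDr mulrC.
- by move=> _ _; rewrite leey.
Qed.

(** With [x] the simple integral, [|I| <= 1 + (x - I)^2 + x^2]. The three expectations are at most
    1, 1 and [16 * (2 + 2 * K ^+ 2 * t)], whose sum is the stated constant. *)
Lemma ito_integral_abs_le :
  (\int[P]_w `|I w|%:E <= (34 + 32 * K ^+ 2 * t)%:E)%E.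
Proof.
have [S [S1 S2]] := approx ltr01.
have [mSI iSI] := simple_integral_sqr_integrable S l t0.
have mI := ito_integral_measurable.
apply: (@le_trans _ _ (\int[P]_w (1 +
   (((simple_integral S (W l) t w - I w) ^+ 2)%:E +
    (simple_integral S (W l) t w ^+ 2)%:E)))%E).
  apply: ge0_le_integralT => w; first by rewrite lee_fin.
  rewrite -!EFinD lee_fin; set x := simple_integral _ _ _ _.
  exact: normr_le_sqrD.
rewrite ge0_integralD//; last 2 first.
- by move=> w _; rewrite -EFinD lee_fin addr_ge0 ?sqr_ge0.
- by apply: emeasurable_funD; apply/measurable_EFinP; apply: measurable_funX => //;
    exact: measurable_funB.
rewrite ge0_integralD//; last 4 first.
- by move=> w _; rewrite lee_fin sqr_ge0.
- by apply/measurable_EFinP; apply: measurable_funX; exact: measurable_funB.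
- by move=> w _; rewrite lee_fin sqr_ge0.
- by apply/measurable_EFinP; exact: measurable_funX.
rewrite integral_cst//= probability_setT mule1.
apply: (@le_trans _ _ (1 + (1 + (16 * (2 + 2 * K ^+ 2 * t))%:E))%E).
  by rewrite leeD2l// leeD// simple_integral_bound.
by rewrite -!EFinD lee_fin le_eqVlt; apply/orP; left; apply/eqP; ring.
Qed.

Lemma ito_integral_integrable : P.-integrable setT (EFin \o I).
Proof.
apply/integrableP; split.
  by apply/measurable_EFinP; exact: ito_integral_measurable.
exact: le_lt_trans ito_integral_abs_le (ltry _).
Qed.

Lemma ito_integral_mean : (\int[P]_w (I w)%:E = 0)%E.
Proof.
have mI := ito_integral_measurable; have iI := ito_integral_integrable.
have fI := integrable_fin_num measurableT iI.
suff : `|\int[P]_w (I w)%:E|%E = 0%E by move/eqP; rewrite abse_eq0 => /eqP.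
apply/eqP; rewrite eq_le abse_ge0 andbT; apply/lee_addgt0Pr => e e0; rewrite add0e.
(* The tolerance [e ^+ 2] is chosen so that the first-moment error is at most
   [e / 2 + e ^+ 2 / (2 * e) = e]. *)
have [S [_ S2]] := approx (exprn_gt0 2 e0).
have [mSI iSI] := simple_integral_sqr_integrable S l t0.
have iSI1 := sqr_integrable_integrable (conj mSI iSI).
have -> : (\int[P]_w (I w)%:E = \int[P]_w (I w - simple_integral S (W l) t w)%:E)%E.
  under [RHS]eq_integral do rewrite EFinB.
  by rewrite integralB// simple_integral_mean// sube0.
apply: (@le_trans _ _ (\int[P]_w `|(I w - simple_integral S (W l) t w)%:E|)%E).
  apply: le_abse_integral => //.
  by apply/measurable_EFinP; exact: measurable_funB.
apply: (@le_trans _ _ (\int[P]_w ((e / 2)%:E +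
   (2 * e)^-1%:E * ((simple_integral S (W l) t w - I w) ^+ 2)%:E))%E).
  apply: ge0_le_integralT => w; first by rewrite abse_ge0.
  by rewrite -EFinM -EFinD /= lee_fin distrC normr_le_half_sqr.
rewrite ge0_integralD//; last 3 first.
- by move=> w _; rewrite lee_fin divr_ge0// ltW.
- by move=> w _; rewrite mule_ge0 ?lee_fin ?sqr_ge0// invr_ge0 mulr_ge0// ltW.
- apply: emeasurable_funM => //.
  by apply/measurable_EFinP; apply: measurable_funX; exact: measurable_funB.
rewrite integral_cst//= probability_setT mule1 ge0_integralZl//; last 3 first.
- by apply/measurable_EFinP; apply: measurable_funX; exact: measurable_funB.
- by move=> w _; rewrite lee_fin sqr_ge0.
- by rewrite lee_fin invr_ge0 mulr_ge0// ltW.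
apply: (@le_trans _ _ ((e / 2)%:E + (2 * e)^-1%:E * (e ^+ 2)%:E)%E).
  by rewrite leeD2l// lee_wpmul2l// lee_fin invr_ge0 mulr_ge0// ltW.
rewrite -EFinM -EFinD lee_fin expr2 invfM mulrACA mulVf ?gt_eqF// mulr1.
by rewrite (mulrC 2^-1) -splitr.
Qed.

End ito_integral_moments.

End ito_moments.

(** * Scalar linear equations *)

Section comparison.
Context {R : realType}.
Implicit Types (D h Y G M : R -> R) (s t T K : R).
Local Notation mu := (@lebesgue_measure R).

(** If [D t < 0], let [z] be the last time before [t] at which [D] is non-negative. Continuity
    forces [D z = 0], and [D] is negative from [z] on up to [t]; the monotonicity hypothesis on
    [[z, t]] then gives [D z <= D t], a contradiction. *)
Lemma lipschitz_comparison T L D : 0 <= D 0 ->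
  (forall s t, 0 <= s -> s <= t -> t <= T -> `|D t - D s| <= L * (t - s)) ->
  (forall s t, 0 <= s -> s <= t -> t <= T ->
    (forall u, s <= u <= t -> D u <= 0) -> D s <= D t) ->
  forall t, 0 <= t <= T -> 0 <= D t.
Proof.
move=> D0 DL Dmono t /andP[t0 tT]; rewrite leNgt; apply/negP => Dt.
pose A := [set s | 0 <= s <= t /\ 0 <= D s].
have A0 : A 0 by split; rewrite ?lexx.
have supA : has_sup A by split; [exists 0|exists t => s [/andP[]]].
pose z := sup A.
have z0 : 0 <= z by apply: ub_le_sup => //; case: supA.
have zt : z <= t by apply: ge_sup; [exists 0|move=> s [/andP[]]].
pose L' := `|L| + 1.
(* [L] carries no sign assumption; [L'] is a strictly positive Lipschitz constant by which one can
   divide. *)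
have L'0 : 0 < L' by rewrite ltr_wpDl.
have DL' s u : 0 <= s -> s <= u -> u <= t -> `|D u - D s| <= L' * (u - s).
  move=> s0 su ut; apply: le_trans (DL s u s0 su (le_trans ut tT)) _.
  by rewrite ler_wpM2r ?subr_ge0// (le_trans (ler_norm _))// lerDl.
have Dz0 : 0 <= D z.
  rewrite leNgt; apply/negP => Dz.
  have e0 : 0 < - D z / L' by rewrite divr_gt0// oppr_gt0.
  have [s [/andP[s0 st] Ds]] := sup_adherent e0 supA; rewrite -/z => zs.
  have sz : s <= z by apply: ub_le_sup; [case: supA|split => //; rewrite s0].
  have := DL' s z s0 sz zt; rewrite ler_norml => /andP[+ _].
  rewrite lerNl opprB => /(le_trans (lerB Ds (lexx _))).
  by rewrite sub0r leNgt -ltr_pdivlMl// mulrC ltrBlDr -ltrBlDl zs.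
have above u : z < u -> u <= t -> D u < 0.
  move=> zu ut; rewrite ltNge; apply/negP => Du.
  suff : u <= z by rewrite leNgt zu.
  by apply: ub_le_sup; [case: supA|split => //; rewrite ut (le_trans z0 (ltW zu))].
have zlt : z < t.
  by rewrite lt_neqAle zt andbT; apply/eqP => E; move: Dz0; rewrite E leNgt Dt.
have Dz : D z <= 0.
  rewrite leNgt; apply/negP => Dz.
  (* Were [D z] positive, the Lipschitz bound would keep [D] non-negative at [z + e], beyond the
     last such time. *)
  pose e := Num.min (t - z) (D z / L').
  have e0 : 0 < e by rewrite lt_min subr_gt0 zlt divr_gt0.
  have zet : z + e <= t by rewrite -lerBrDl ge_min lexx.
  have := DL' z (z + e) z0; rewrite lerDl (ltW e0) => /(_ isT zet).
  rewrite ler_norml => /andP[+ _]; rewrite lerNl opprB (addrC z) addrK.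
  have -> : D z - D (e + z) <= L' * e = false; last by [].
  apply/negbTE; rewrite -ltNge (@le_lt_trans _ _ (D z))//.
    by rewrite mulrC -ler_pdivlMr// ge_min lexx orbT.
  by rewrite ltrDl oppr_gt0 addrC above// ltrDl.
have := Dmono z t z0 zt tT; rewrite leNgt (lt_le_trans Dt Dz0) => /(_ _)/negP.
apply => // u /andP[zu ut]; have := zu; rewrite le_eqVlt => /orP[/eqP <-//|zu'].
exact/ltW/above.
Qed.

(** This class is stable under the operations used below, and its members have Lipschitz primitives,
    which is all the regularity that the comparison argument asks for. *)
Definition bounded_measurable T h := measurable_fun `[0, T] h /\
  exists K, forall s, 0 <= s <= T -> `|h s| <= K.

Lemma bounded_measurableW S T h : S <= T ->
  bounded_measurable T h -> bounded_measurable S h.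
Proof.
move=> ST [mh [K hK]]; split.
  apply: measurable_funS mh => // s /=; rewrite !in_itv/= => /andP[-> sS].
  exact: le_trans sS ST.
by exists K => s /andP[s0 sS]; rewrite hK// s0 (le_trans sS ST).
Qed.

Lemma eq_bounded_measurable T h h' : (forall s, 0 <= s <= T -> h s = h' s) ->
  bounded_measurable T h -> bounded_measurable T h'.
Proof.
move=> hh' [mh [K hK]]; split; last by exists K => s sT; rewrite -hh'// hK.
by apply: eq_measurable_fun mh => s; rewrite inE/= in_itv/=; exact: hh'.
Qed.

Lemma bounded_measurableD T h h' : bounded_measurable T h ->
  bounded_measurable T h' -> bounded_measurable T (fun s => h s + h' s).
Proof.
move=> [mh [K hK]] [mh' [K' hK']]; split; first exact: measurable_funD.
by exists (K + K') => s sT; rewrite (le_trans (ler_normD _ _))// lerD ?hK ?hK'.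
Qed.

Lemma bounded_measurableZ T k h : bounded_measurable T h ->
  bounded_measurable T (fun s => k * h s).
Proof.
move=> [mh [K hK]]; split; first exact: measurable_funM.
by exists (`|k| * K) => s sT; rewrite normrM ler_wpM2l// hK.
Qed.

Lemma bounded_measurableN T h : bounded_measurable T h ->
  bounded_measurable T (fun s => - h s).
Proof.
move=> /(bounded_measurableZ (-1)); apply: eq_bounded_measurable => s _.
by rewrite mulN1r.
Qed.

Lemma bounded_measurable_norm T h : bounded_measurable T h ->
  bounded_measurable T (fun s => `|h s|).
Proof.
move=> [mh [K hK]]; split; first exact: measurableT_comp.
by exists K => s sT; rewrite normr_id hK.
Qed.

Lemma bounded_measurable_cst T k : bounded_measurable T (fun=> k).
Proof. by split => //; exists `|k|. Qed.

Lemma continuous_bounded_measurable T h :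
  {within `[0, T], continuous h} -> bounded_measurable T h.
Proof.
move=> ch; split; first exact: subspace_continuous_measurable_fun.
have [T0|T0] := leP 0 T; last first.
  by exists 0 => s /andP[s0 sT]; have := le_lt_trans (le_trans s0 sT) T0; rewrite ltxx.
have /compact_bounded[K [_ hK]] : compact (h @` `[0, T]).
  by apply: continuous_compact => //; exact: segment_compact.
exists (K + 1) => s sT; apply: hK; first by rewrite ltrDl.
by exists s => //=; rewrite in_itv.
Qed.

Lemma bounded_measurable_integrable T h t : bounded_measurable T h -> t <= T ->
  mu.-integrable `[0, t] (EFin \o h).
Proof.
move=> bh tT; have [mh [K hK]] := bounded_measurableW tT bh.
apply: measurable_bounded_integrable => //.
  by rewrite [ltLHS](lebesgue_measure_itv `[0, t])/=; case: ifP => // _; rewrite -EFinB ltry.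
exists K; split; first exact: num_real.
move=> x Kx s /=; rewrite in_itv/= => st.
by apply: le_trans (ltW Kx); exact: hK.
Qed.

Lemma integral_increment T h K s t : measurable_fun `[0, T] h ->
  (forall s, 0 <= s <= T -> `|h s| <= K) -> 0 <= s -> s <= t -> t <= T ->
  [/\ (\int[mu]_(u in `[0, t]) h u - \int[mu]_(u in `[0, s]) h u =
       \int[mu]_(u in `]s, t]) h u)%R,
    mu.-integrable `]s, t] (EFin \o h) &
    `|\int[mu]_(u in `[0, t]) h u - \int[mu]_(u in `[0, s]) h u| <= K * (t - s)].
Proof.
move=> mh hK s0 st tT.
have bh : bounded_measurable T h by split => //; exists K.
have ih := bounded_measurable_integrable bh tT.
have ist : mu.-integrable `]s, t] (EFin \o h).
  apply: integrableS ih => // u /=; rewrite !in_itv/= => /andP[/ltW su ->].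
  by rewrite (le_trans s0 su).
have E := Rintegral_itvB ih (a := BLeft 0) (x := s) (b := BRight t) _ _.
rewrite E; try by rewrite bnd_simp.
split => //; apply: le_trans (le_normr_Rintegral _ ist) _ => //.
apply: (@le_trans _ _ (\int[mu]_(u in `]s, t]) K)).
  apply: le_Rintegral => //.
  - exact: integrable_norm.
  - apply: measurable_bounded_integrable => //.
      by rewrite [ltLHS](lebesgue_measure_itv `]s, t])/=; case: ifP => // _; rewrite -EFinB ltry.
    exists `|K|; split; first exact: num_real.
    by move=> x Kx u _; exact: ltW.
  - move=> u /=; rewrite in_itv/= => /andP[/ltW su ut].
    by apply: hK; rewrite (le_trans s0 su) (le_trans ut tT).
rewrite Rintegral_cst// [X in fine X](lebesgue_measure_itv `]s, t])/= lte_fin.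
by move: st; rewrite le_eqVlt => /orP[/eqP ->|->//]; rewrite ltxx subrr.
Qed.

(** A derivative that is non-negative wherever [D <= 0] makes [D] non-decreasing there, so [D]
    cannot leave the non-negative half-line. *)
Lemma integral_comparison T D h d0 : 0 <= d0 -> bounded_measurable T h ->
  (forall t, 0 <= t <= T -> D t = d0 + \int[mu]_(s in `[0, t]) h s) ->
  (forall t, 0 <= t <= T -> D t <= 0 -> 0 <= h t) ->
  forall t, 0 <= t <= T -> 0 <= D t.
Proof.
move=> d00 [mh [K hK]] DE h0 t tT; have T0 : 0 <= T by case/andP: tT => /le_trans; apply.
have incr s u : 0 <= s -> s <= u -> u <= T ->
    D u - D s = \int[mu]_(v in `[0, u]) h v - \int[mu]_(v in `[0, s]) h v.
  move=> s0 su uT; rewrite !DE ?s0 ?uT ?(le_trans s0 su) ?(le_trans su uT)//.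
  by rewrite opprD addrACA subrr add0r.
apply: (@lipschitz_comparison T K) tT.
- by rewrite DE ?lexx// set_itv1 Rintegral_set1 addr0.
- move=> s u s0 su uT; rewrite incr//.
  by have [] := integral_increment mh hK s0 su uT.
- move=> s u s0 su uT Dneg; rewrite -subr_ge0 incr//.
  have [-> _ _] := integral_increment mh hK s0 su uT.
  apply: Rintegral_ge0 => v /=; rewrite in_itv/= => /andP[/ltW sv vu].
  apply: h0; first by rewrite (le_trans s0 sv) (le_trans vu uT).
  by apply: Dneg; rewrite sv vu.
Qed.

Lemma bounded_measurable_primitive T h : bounded_measurable T h ->
  bounded_measurable T (fun t => \int[mu]_(s in `[0, t]) h s).
Proof.
move=> bh; have [T0|T0] := leP 0 T; last first.
  split; last by exists 0 => s /andP[s0 sT];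
    have := le_lt_trans (le_trans s0 sT) T0; rewrite ltxx.
  by rewrite set_itv_ge ?bnd_simp -?ltNge//; exact: measurable_fun_set0.
apply: continuous_bounded_measurable.
exact: parameterized_integral_continuous T0 (bounded_measurable_integrable bh (lexx T)).
Qed.

(* The noise [M] has no regularity in time, but [Y - M] is absolutely
   continuous, so the comparison argument applies to it path by path. *)
Lemma linear_equation_upper T nu y0 Y G M : 0 <= nu ->
  bounded_measurable T Y -> bounded_measurable T G -> bounded_measurable T M ->
  (forall t, 0 <= t <= T ->
    Y t = y0 + \int[mu]_(s in `[0, t]) (- nu * Y s + G s) + M t) ->
  forall t, 0 <= t <= T ->
  Y t - M t <= `|y0| + \int[mu]_(s in `[0, t]) (`|G s| + nu * `|M s|).
Proof.
move=> nu0 bY bG bM YE t tT.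
have bZ : bounded_measurable T (fun s => - nu * Y s + G s).
  by apply: bounded_measurableD => //; exact: bounded_measurableZ.
have bU : bounded_measurable T (fun s => `|G s| + nu * `|M s|).
  apply: bounded_measurableD; first exact: bounded_measurable_norm.
  by apply/bounded_measurableZ/bounded_measurable_norm.
rewrite -subr_ge0.
pose D t := `|y0| + \int[mu]_(s in `[0, t]) (`|G s| + nu * `|M s|) - (Y t - M t).
apply: (@integral_comparison T D
  (fun s => (`|G s| + nu * `|M s|) - (- nu * Y s + G s)) (`|y0| - y0)) tT.
- by rewrite subr_ge0 ler_norm.
- by apply: bounded_measurableD => //; exact: bounded_measurableN.
- move=> s /[dup] sT /andP[_ sT']; rewrite /D YE// addrK RintegralB//.
  + by rewrite opprD addrACA.
  + exact: bounded_measurable_integrable bU sT'.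
  + exact: bounded_measurable_integrable bZ sT'.
- move=> s sT Ds.
  have U0 : 0 <= \int[mu]_(u in `[0, s]) (`|G u| + nu * `|M u|).
    by apply: Rintegral_ge0 => u _; rewrite addr_ge0// mulr_ge0.
  have YM : 0 <= Y s - M s.
    by move: Ds; rewrite /D subr_le0; apply: le_trans; rewrite addr_ge0.
  (* The regrouping shows only non-negative terms, given that [Y - M] is non-negative where the
     bound fails. *)
  have -> : `|G s| + nu * `|M s| - (- nu * Y s + G s) =
    (`|G s| - G s) + nu * ((Y s - M s) + (`|M s| + M s)) by ring.
  have MM : 0 <= `|M s| + M s by rewrite -lerBlDr sub0r -normrN ler_norm.
  by rewrite addr_ge0 ?subr_ge0 ?ler_norm// mulr_ge0// addr_ge0.
Qed.

(** The one-sided bound is applied to the equation and to its negative, for which its right-hand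
    side is the same. *)
Lemma linear_equation_norm T nu y0 Y G M : 0 <= nu ->
  bounded_measurable T Y -> bounded_measurable T G -> bounded_measurable T M ->
  (forall t, 0 <= t <= T ->
    Y t = y0 + \int[mu]_(s in `[0, t]) (- nu * Y s + G s) + M t) ->
  forall t, 0 <= t <= T ->
  `|Y t| <= `|y0| + \int[mu]_(s in `[0, t]) (`|G s| + nu * `|M s|) + `|M t|.
Proof.
move=> nu0 bY bG bM YE t /[dup] tT /andP[_ tT'].
have upper := linear_equation_upper nu0 bY bG bM YE tT.
have lower : - Y t - - M t <=
    `|- y0| + \int[mu]_(s in `[0, t]) (`|- G s| + nu * `|- M s|).
  apply: (@linear_equation_upper T nu (- y0) (fun s => - Y s) (fun s => - G s)
    (fun s => - M s)) => //; try exact: bounded_measurableN.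
  move=> s /[dup] sT /andP[_ sT']; rewrite YE// !opprD; congr (_ + _ - _).
  rewrite -[LHS]mulN1r -RintegralZl//; last first.
    apply: bounded_measurable_integrable sT'.
    by apply: bounded_measurableD => //; exact: bounded_measurableZ.
  by apply: eq_Rintegral => u _; ring.
have absN : \int[mu]_(s in `[0, t]) (`|- G s| + nu * `|- M s|) =
    \int[mu]_(s in `[0, t]) (`|G s| + nu * `|M s|).
  by apply: eq_Rintegral => s _; rewrite !normrN.
move: lower; rewrite absN => lower.
move: upper lower; rewrite normrN; set B := `|y0| + _ => upper lower.
have := ler_norm (M t); have := ler_norm (- M t); rewrite normrN => M1 M2.
rewrite ler_norml; apply/andP; split.
  by rewrite lerNl (le_trans _ (lerD lower M1))// subrK.
by rewrite (le_trans _ (lerD upper M2))// subrK.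
Qed.

(** The derivative of [b - a] is [- nu * (b - a) + (v - u)], which is non-negative wherever
    [b - a <= 0]. *)
Lemma linear_equation_compare T nu y0 (a b u v : R -> R) :
  bounded_measurable T a -> bounded_measurable T b ->
  bounded_measurable T u -> bounded_measurable T v -> 0 <= nu ->
  (forall t, 0 <= t <= T ->
    a t = y0 + \int[mu]_(s in `[0, t]) (- nu * a s + u s)) ->
  (forall t, 0 <= t <= T ->
    b t = y0 + \int[mu]_(s in `[0, t]) (- nu * b s + v s)) ->
  (forall t, 0 <= t <= T -> u t <= v t) ->
  forall t, 0 <= t <= T -> a t <= b t.
Proof.
move=> ba bb bu bv nu0 aE bE uv t tT.
have bau : bounded_measurable T (fun s => - nu * a s + u s).
  by apply: bounded_measurableD => //; exact: bounded_measurableZ.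
have bbv : bounded_measurable T (fun s => - nu * b s + v s).
  by apply: bounded_measurableD => //; exact: bounded_measurableZ.
rewrite -subr_ge0; apply: (@integral_comparison T (fun t => b t - a t)
  (fun s => (- nu * b s + v s) - (- nu * a s + u s)) 0) tT => //.
- by apply: bounded_measurableD => //; exact: bounded_measurableN.
- move=> s /[dup] sT /andP[_ sT']; rewrite aE// bE// RintegralB//.
  + by rewrite add0r opprD addrACA subrr add0r.
  + exact: bounded_measurable_integrable bbv sT'.
  + exact: bounded_measurable_integrable bau sT'.
- move=> s sT Ds.
  rewrite (_ : _ - _ = nu * - (b s - a s) + (v s - u s)); last by ring.
  by rewrite addr_ge0 ?subr_ge0 ?uv// mulr_ge0// oppr_ge0.
Qed.

End comparison.

(** * The matrix exponential *)

Section exponential_profiles.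
Context {R : realType}.
Variable nu : R.
Implicit Types (q r n : nat) (t b : R) (y : nat -> R).

Definition exp_profile r t : R := expR (- (nu * t)) * (t ^+ r / r`!%:R).

Definition exp_profile_pred r t : R :=
  if r is r'.+1 then exp_profile r' t else 0.

Lemma is_derive_exp_profile r t : is_derive t 1 (exp_profile r)
  (- nu * exp_profile r t + exp_profile_pred r t).
Proof.
have d1 : is_derive t 1 (fun s : R => - (nu * s)) (- nu).
  have := is_deriveN (is_deriveZ nu (is_derive_id t 1)).
  by rewrite [nu *: 1]mulr1.
have d2 := @is_derive1_comp R expR (fun s => - (nu * s)) t _ _
  (is_derive_expR (- (nu * t))) d1.
have d3 : is_derive t 1 (fun s : R => s ^+ r / r`!%:R)
    ((r%:R * t ^+ r.-1) / r`!%:R).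
  have := is_deriveZ (r`!%:R^-1) (is_deriveX r (is_derive_id t 1)).
  rewrite exprfctE [_ *: 1]mulr1 [_ *: _]mulrC.
  by congr is_derive; apply/funext => s /=; exact: mulrC.
have := is_deriveM d2 d3; rewrite /GRing.scale/=.
have -> // : expR (- (nu * t)) * (r%:R * t ^+ r.-1 / r`!%:R) +
    t ^+ r / r`!%:R * (expR (- (nu * t)) * - nu) =
  - nu * exp_profile r t + exp_profile_pred r t.
rewrite /exp_profile_pred /exp_profile addrC; congr (_ + _); first by ring.
case: r {d3} => [|r]; first by rewrite !mul0r mulr0.
rewrite factS natrM /=; field.
by rewrite addrC natr1 !pnatr_eq0 -!lt0n fact_gt0.
Qed.

Lemma exp_profile0 r : exp_profile r 0 = (r == 0%N)%:R.
Proof.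
rewrite /exp_profile mulr0 oppr0 expR0 mul1r expr0n.
by case: eqP => [->|_]; rewrite ?fact0 ?divr1// mul0r.
Qed.

Definition exp_sum (a : nat -> R) n t := \sum_(r < n) a r * exp_profile r t.

Lemma is_derive_exp_sum a n t : is_derive t 1 (exp_sum a n)
  (- nu * exp_sum a n t + exp_sum (fun r => a r.+1) n.-1 t).
Proof.
have -> : exp_sum a n = \sum_(r < n) (a r \*: exp_profile r).
  by apply/funext => s; rewrite fct_sumE.
have := @is_derive_sum _ _ _ n (fun r : 'I_n => a r \*: exp_profile r) t 1 _
  (fun r : 'I_n => is_deriveZ (a r) (is_derive_exp_profile r t)).
congr is_derive; rewrite /GRing.scale/= fct_sumE mulr_sumr.
under eq_bigr do rewrite mulrDr.
rewrite big_split/=; congr (_ + _).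
  by apply: eq_bigr => r _; rewrite /= /GRing.scale/= mulrCA.
case: n => [|n]; first by rewrite /exp_sum !big_ord0.
by rewrite big_ord_recl/= mulr0 add0r.
Qed.

Lemma exp_sum_at0 a n : exp_sum a n.+1 0 = a 0%N.
Proof.
rewrite /exp_sum big_ord_recl exp_profile0 mulr1 big1 ?addr0// => r _.
by rewrite exp_profile0 mulr0.
Qed.

(** The right-hand side of the theorem at distance [q] from the end of a block: the first sum is the
    homogeneous solution started from [y], and [b / nu ^+ q.+1] is the equilibrium of the chain
    under the constant forcing [b], weighted by the time factor. *)
Definition chain_bound y b q t := exp_sum (fun r => y (q - r)%N) q.+1 t +
  (1 - exp_sum (fun r => nu ^+ r) q.+1 t) * (b / nu ^+ q.+1).

Lemma chain_bound0 y b q : chain_bound y b q 0 = y q.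
Proof. by rewrite /chain_bound !exp_sum_at0 subn0 expr0 subrr mul0r addr0. Qed.

Lemma is_derive_chain_bound y b q t : nu != 0 ->
  is_derive t 1 (chain_bound y b q)
  (- nu * chain_bound y b q t + if q is q'.+1 then chain_bound y b q' t else b).
Proof.
move=> nu0; set k := b / nu ^+ q.+1.
have fE : chain_bound y b q = exp_sum (fun r => y (q - r)%N) q.+1 +
    k \*: (cst 1 - exp_sum (fun r => nu ^+ r) q.+1).
  by apply/funext => s; rewrite /chain_bound/= mulrC.
rewrite [X in is_derive _ _ X _]fE.
have := is_deriveD (is_derive_exp_sum (fun r => y (q - r)%N) q.+1 t)
  (is_deriveZ k (is_deriveB (is_derive_cst (1 : R) t 1)
    (is_derive_exp_sum (fun r => nu ^+ r) q.+1 t))).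
congr is_derive; rewrite /GRing.scale/= /chain_bound -/k.
(* Differentiation shifts the coefficients, which costs a factor [nu] here; [nu * k] is the
   equilibrium of the preceding member of the chain, or [b] itself when [q] is 0. *)
have -> : exp_sum (fun r => nu ^+ r.+1) q t = nu * exp_sum (fun r => nu ^+ r) q t.
  by rewrite /exp_sum mulr_sumr; apply: eq_bigr => r _; rewrite exprS mulrA.
case: q @k {fE} => [|q] k.
  rewrite /exp_sum !big_ord0 !big_ord_recl !big_ord0 /k expr1; field.
  exact: nu0.
have -> : b / nu ^+ q.+1 = nu * k by rewrite /k [nu ^+ q.+2]exprS; field; rewrite expf_neq0.
under [exp_sum (fun r => y (q.+1 - r.+1)%N) _ _]eq_bigr do rewrite subSS.
rewrite -/(exp_sum (fun r => y (q - r)%N) q.+1 t); ring.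
Qed.

Lemma chain_bound_bounded_measurable y b q T : nu != 0 ->
  bounded_measurable T (chain_bound y b q).
Proof.
move=> nu0; apply: continuous_bounded_measurable; apply: continuous_subspaceT => t.
apply: differentiable_continuous; apply/derivable1_diffP.
by case: (is_derive_chain_bound y b q t nu0).
Qed.

Lemma chain_bound_integral y b q t : nu != 0 -> 0 <= t ->
  chain_bound y b q t = y q + \int[lebesgue_measure]_(s in `[0, t])
   (- nu * chain_bound y b q s + if q is q'.+1 then chain_bound y b q' s else b).
Proof.
move=> nu0; rewrite le_eqVlt => /orP[/eqP <-|t0].
  by rewrite set_itv1 Rintegral_set1 addr0 chain_bound0.
have dU p s := is_derive_chain_bound y b p s nu0.
have cU p : continuous (chain_bound y b p).
  move=> s; apply: differentiable_continuous; apply/derivable1_diffP.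
  by case: (dU p s).
rewrite /Rintegral (@continuous_FTC2 _ _ (chain_bound y b q) _ _ t0).
- by rewrite /= chain_bound0 addrCA subrr addr0.
- apply: continuous_subspaceT => s; apply: cvgD; first by apply: cvgM; [exact: cvg_cst|exact: cU].
  by case: (q) => [|q']; [exact: cvg_cst|exact: cU].
- split; [by move=> s _; case: (dU q s)|..].
  + by apply: cvg_at_right_filter; exact: cU.
  + by apply: cvg_at_left_filter; exact: cU.
- by move=> s _; rewrite derive1E; case: (dU q s).
Qed.

End exponential_profiles.

(** * Powers and exponential of the block matrix *)

Section matrix_exponential.
Context {R : realType} (eta : 'I_2 -> nat) (nu : 'I_2 -> R).
Local Notation A := (matA eta nu).
Implicit Types (x : state R eta) (k : 'I_2) (q r n : nat) (t : R).

(* Coordinates of a block counted from its last one, so that the chain of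
   equations is solved by increasing index. *)
Definition rev_coord x k q : R :=
  block_coord x (inord (eta k - q) : 'I_(eta k).+1).

Lemma rev_coordE x k (j : 'I_(eta k).+1) :
  block_coord x j = rev_coord x k (eta k - j).
Proof. by rewrite /rev_coord subKn ?inord_val// -ltnS. Qed.

Lemma rev_coord_matA x k q : (q <= eta k)%N -> rev_coord (A *m x) k q =
  - nu k * rev_coord x k q + (if q is q'.+1 then rev_coord x k q' else 0).
Proof.
move=> qk; rewrite /rev_coord /block_coord.
rewrite -[in LHS](submxcolK x) /matA mul_mxdiag_mxcol mxcolK mxE.
set j : 'I_(eta k).+1 := inord (eta k - q).
have jE : j = (eta k - q)%N :> nat by rewrite inordK// ltnS leq_subr.
rewrite (bigD1 j)//= mxE eqxx; congr (_ + _).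
under eq_bigr => i /negbTE ij do rewrite mxE ij.
case: q qk @j jE => [_ j jE|q qk j jE].
  rewrite big1// => i _; rewrite jE subn0 ltn_eqF ?mul0r //.
have q'E : inord (eta k - q) = (eta k - q)%N :> nat :=
  inordK (leq_subr q (eta k) : (eta k - q < (eta k).+1)%N).
rewrite (bigD1 (inord (eta k - q)))/=; last first.
  by apply/eqP => /(congr1 val)/= E; move: jE; rewrite -E q'E; lia.
rewrite big1 => [|i /andP[_ ij]].
  have -> : (inord (eta k - q) : 'I_(eta k).+1) == j.+1 :> nat.
    by rewrite q'E jE; lia.
  by rewrite mul1r addr0.
rewrite (_ : (i : nat) == j.+1 = false) ?mul0r//; apply: contraNF ij => /eqP E.
by apply/eqP/val_inj; rewrite /= E q'E jE; lia.
Qed.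

(** The binomial theorem for [- nu] times the identity plus the nilpotent shift, read on
    coordinates; the induction on [n] is Pascal's rule. *)
Lemma rev_coord_exp x k q t n : (q <= eta k)%N ->
  rev_coord ((t *: A) ^+ n *m x) k q =
  \sum_(r < q.+1) 'C(n, r)%:R * (- nu k) ^+ (n - r) * t ^+ n * rev_coord x k (q - r).
Proof.
elim: n q => [|n IH] q qk.
  rewrite expr0 mul1mx big_ord_recl big1 ?addr0.
    by rewrite bin0 expr0 !mulr1 subn0 mul1r.
  by move=> r _; rewrite bin0n/= !mul0r.
rewrite exprS -mulmxE -mulmxA -scalemxAl.
have -> : rev_coord (t *: (A *m ((t *: A) ^+ n *m x))) k q =
    t * rev_coord (A *m ((t *: A) ^+ n *m x)) k q.
  by rewrite /rev_coord /block_coord !mxE.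
rewrite rev_coord_matA// IH//.
have -> : (if q is q'.+1 then rev_coord ((t *: A) ^+ n *m x) k q' else 0) =
    \sum_(r < q.+1) (if (r : nat) is r'.+1 then
      'C(n, r')%:R * (- nu k) ^+ (n - r') * t ^+ n * rev_coord x k (q - r) else 0).
  case: q qk => [|q] qk; first by rewrite big_ord1.
  by rewrite IH ?(ltnW qk)// [RHS]big_ord_recl add0r; apply: eq_bigr.
rewrite mulr_sumr -big_split/= mulr_sumr; apply: eq_bigr => -[[|r] rq] _ /=.
  by rewrite addr0 !subn0 !bin0 !exprS; ring.
rewrite binS natrD subSS.
(* The exponent [n - r.+1] is a truncated subtraction; where it truncates, the binomial coefficient
   is zero. *)
have [rn|nr] := ltnP r n.
  by rewrite -(subnSK rn) !exprS; ring.
by rewrite (bin_small (nr : (n < r.+1)%N)) !exprS; ring.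
Qed.

(** The terms below [r] vanish. After a shift by [r], the identity
    [C(i + r, r) / (i + r)! = 1 / (i! r!)] factors out [t ^+ r / r!] and leaves the exponential
    series. *)
Lemma cvg_exp_profile (a t : R) r :
  series (fun m => m`!%:R^-1 * ('C(m, r)%:R * (- a) ^+ (m - r) * t ^+ m)) @ \oo -->
  exp_profile a r t.
Proof.
rewrite -(cvg_shiftn r).
have -> : (fun n => series (fun m => m`!%:R^-1 *
    ('C(m, r)%:R * (- a) ^+ (m - r) * t ^+ m)) (n + r)%N) =
  (fun n => (t ^+ r / r`!%:R) * series (exp_coeff (- (a * t))) n).
  apply/funext => n; rewrite /series/= mulr_sumr (big_cat_nat _ (n := r))//=; last exact: leq_addl.
  rewrite big_nat_cond big1 ?add0r; last first.
    by move=> i /andP[/andP[_ ir] _]; rewrite bin_small// !mul0r mulr0.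
  rewrite -{1}(add0n r) big_addn addnK; apply: eq_bigr => i _.
  rewrite addnK /exp_coeff/= exprD -mulNr exprMn.
  have <- := @bin_fact (i + r) r (leq_addl _ _); rewrite addnK !natrM.
  have f0 m : (m`!%:R : R) != 0 by rewrite pnatr_eq0 -lt0n fact_gt0.
  have c0 : ('C(i + r, r)%:R : R) != 0 by rewrite pnatr_eq0 -lt0n bin_gt0 leq_addl.
  by field; rewrite c0 !f0.
rewrite /exp_profile [expR _ * _]mulrC. apply: cvgM; first exact: cvg_cst.
exact: is_cvg_series_exp_coeff.
Qed.

(** [expmx] is an entrywise limit, so the formula for powers is applied to the basis vectors [dl j],
    which single out the entries of a row; linearity then restores [x]. *)
Lemma rev_coord_expmx x t k q : (q <= eta k)%N ->
  rev_coord (expmx (t *: A) *m x) k q =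
  exp_sum (nu k) (fun r => rev_coord x k (q - r)) q.+1 t.
Proof.
move=> qk; rewrite {1}/rev_coord /block_coord /submxcol mxE mxE.
set i := tagnat.Rank _ _.
pose dl j : state R eta := delta_mx j 0.
have expE j : expmx (t *: A) i j =
    exp_sum (nu k) (fun r => rev_coord (dl j) k (q - r)) q.+1 t.
  rewrite mxE; apply: cvg_lim => //.
  have -> : series (fun m => (m`!%:R^-1 *: (t *: A) ^+ m) i j) =
    fun n => \sum_(r < q.+1) rev_coord (dl j) k (q - r) *
      series (fun m => m`!%:R^-1 * ('C(m, r)%:R * (- nu k) ^+ (m - r) * t ^+ m)) n.
    apply/funext => n; rewrite /series/=.
    under [RHS]eq_bigr do rewrite mulr_sumr.
    rewrite exchange_big/=; apply: eq_bigr => m _; rewrite mxE.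
    have -> : ((t *: A) ^+ m) i j = rev_coord ((t *: A) ^+ m *m dl j) k q.
      by rewrite /rev_coord /block_coord /submxcol mxE -/i -colE mxE.
    by rewrite rev_coord_exp// mulr_sumr; apply: eq_bigr => r _; ring.
  rewrite /exp_sum; apply: (@cvg_big R^o) => [|r _]; first exact: add_continuous.
  apply: cvgM; first exact: cvg_cst.
  exact: cvg_exp_profile.
under eq_bigr do rewrite expE /exp_sum mulr_suml.
rewrite exchange_big/=; apply: eq_bigr => r _.
under eq_bigr do rewrite mulrAC.
rewrite -mulr_suml; congr (_ * _).
rewrite /rev_coord /block_coord /submxcol !mxE; set i' := tagnat.Rank _ _.
transitivity (\sum_l (i' == l)%:R * x l 0).
  by apply: eq_bigr => l _; rewrite !mxE andbT.
rewrite (bigD1 i')//= eqxx/= mul1r [X in _ + X]big1 ?addr0// => l li.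
by rewrite eq_sym (negbTE li) mul0r.
Qed.

End matrix_exponential.

(** * Means of continuous processes *)

Section continuous_processes.
Context d (Omega : measurableType d) (R : realType) (P : probability Omega R).
Implicit Types (Y Z G M : R -> Omega -> R) (s t T K : R).
Local Notation mu := (@lebesgue_measure R).

Definition continuous_process Y :=
  (forall s, 0 <= s -> measurable_fun setT (Y s)) /\
  (forall w, {within `[0, +oo[, continuous (Y ^~ w)}).

Definition L1_bounded T Y := exists K, forall s, 0 <= s <= T ->
  (\int[P]_w `|Y s w|%:E <= K%:E)%E.

Let halfline_cvgP (h : R -> R) : {within `[0, +oo[, continuous h} <->
  (forall x : R, 0 <= x -> h @ within `[0%R, +oo[%classic (nbhs x) --> h x).
Proof.
rewrite subspace_continuousP; split => hc x; first by move=> x0; apply: hc; rewrite /= in_itv/= x0.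
by rewrite /= in_itv/= andbT => /hc.
Qed.

Lemma continuous_process_cst k : continuous_process (fun _ _ => k).
Proof.
split => [s _|w]; first exact: measurable_cst.
by apply/halfline_cvgP => x _; exact: cvg_cst.
Qed.

Lemma continuous_processD Y Z : continuous_process Y -> continuous_process Z ->
  continuous_process (fun s w => Y s w + Z s w).
Proof.
move=> [mY cY] [mZ cZ]; split => [s s0|w].
  exact: measurable_funD (mY s s0) (mZ s s0).
apply/halfline_cvgP => x x0; apply: cvgD; last exact: (halfline_cvgP _).1.
exact: (halfline_cvgP _).1.
Qed.

Lemma continuous_process_comp (f : R -> R) Y : continuous f ->
  continuous_process Y -> continuous_process (fun s w => f (Y s w)).
Proof.
move=> cf [mY cY]; split => [s s0|w].
  exact: measurableT_comp (continuous_measurable_fun cf) (mY s s0).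
apply/halfline_cvgP => x x0; apply: (cvg_comp _ f _ (cf (Y x w))).
exact: (halfline_cvgP _).1.
Qed.

Lemma continuous_processZ k Y : continuous_process Y ->
  continuous_process (fun s w => k * Y s w).
Proof. by apply: continuous_process_comp; exact: mulrl_continuous. Qed.

Lemma continuous_process_norm Y : continuous_process Y ->
  continuous_process (fun s w => `|Y s w|).
Proof. by apply: continuous_process_comp; exact: norm_continuous. Qed.

Lemma continuous_process_bounded_measurable T Y w : continuous_process Y ->
  bounded_measurable T (Y ^~ w).
Proof.
move=> [_ cY]; apply: continuous_bounded_measurable.
apply: continuous_subspaceW (cY w) => s /=.
by rewrite !in_itv/= andbT => /andP[].
Qed.

(* The countably many times [truncn (n.+1 * s) / n.+1] converge to [Num.max s 0],
   so path continuity turns measurability in [w] into joint measurability. *)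
Lemma continuous_process_measurable Y : continuous_process Y ->
  measurable_fun setT (fun z : R * Omega => Y (Num.max z.1 0) z.2).
Proof.
move=> [mY cY].
pose k n s : nat := Num.truncn (n.+1%:R * s).
pose tm n m : R := m%:R / n.+1%:R.
have tm0 n m : 0 <= tm n m by rewrite divr_ge0.
apply: (@measurable_fun_cvg _ _ _ _ (fun n z => Y (tm n (k n z.1)) z.2)).
- move=> n _ B mB; rewrite setTI.
  have -> : (fun z : R * Omega => Y (tm n (k n z.1)) z.2) @^-1` B =
    \bigcup_m ([set s | k n s = m] `*` (Y (tm n m) @^-1` B)).
    apply/seteqP; split => [[s w] /= Bsw|[s w] [m _ [/= <-]]//].
    by exists (k n s).
  apply: bigcup_measurable => m _; apply: measurableX.
    (* [k n] is non-decreasing in time, so its level sets are intervals. *)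
    apply: is_interval_measurable => x y /= xm ym z /andP[xz zy].
    apply/eqP; rewrite eqn_leq -{1}ym -xm /k.
    by rewrite !le_truncn// ler_wpM2l.
  by rewrite -[X in measurable X]setTI; exact: mY.
- move=> [s w] _ /=.
  have x0 : 0 <= Num.max s 0 by rewrite le_max lexx orbT.
  apply: cvg_trans ((halfline_cvgP _).1 (cY w) _ x0).
  apply: (@cvg_comp _ _ _ (fun n => tm n (k n s)) (Y ^~ w)); last exact: cvg_id.
  move=> A /= [e e0 eA]; have := near_infty_natSinv_lt (PosNum e0).
  apply: filterS => n ne; apply: eA; last by rewrite /= in_itv/= tm0.
  rewrite /= (le_lt_trans _ ne)//=.
  have n0 : 0 < n.+1%:R :> R by [].
  have [s0|s0] := leP 0 s.
    have := truncn_itv (mulr_ge0 (ltW n0) s0); rewrite -/(k n s) => /andP[k1 k2].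
    rewrite ger0_norm ?subr_ge0; last by rewrite /tm ler_pdivrMr// mulrC.
    rewrite lerBlDr -[X in X + _]mul1r -mulrDl ler_pdivlMr// mulrC addrC natr1.
    exact: ltW.
  have -> : k n s = 0%N.
    by apply/eqP; rewrite -leqn0 -(truncn0 R) le_truncn// nmulr_lle0// ?pmulr_rle0// ltW.
  by rewrite /tm mul0r subr0 normr0.
Qed.

Section time_integral.
Variables (t T : R) (Y : R -> Omega -> R).
Hypotheses (t0 : 0 <= t) (tT : t <= T) (cY : continuous_process Y).

(** Nothing is known of the process at negative times: [Num.max] gives joint measurability on the
    whole line, and the indicator restricts the integral to [[0, t]]. *)
Let f (z : Omega * measurableTypeR R) : \bar R :=
  (Y (Num.max z.2 0) z.1 * \1_(`[0, t]) z.2)%:E.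

Let mf : measurable_fun setT f.
Proof.
apply/measurable_EFinP; apply: measurable_funM.
  apply: (@measurableT_comp _ _ _ _ _ _ (fun z : R * Omega => Y (Num.max z.1 0) z.2) _
    (fun z : Omega * measurableTypeR R => (z.2, z.1))).
    exact: continuous_process_measurable.
  exact: measurable_swap.
by apply: (measurableT_comp _ measurable_snd); exact: measurable_indic.
Qed.

Let fE (w : Omega) : (\int[mu]_s f (w, s) = (\int[mu]_(s in `[0, t]) Y s w)%:E)%E.
Proof.
rewrite /Rintegral fineK; last first.
  apply: integrable_fin_num => //.
  exact: bounded_measurable_integrable (continuous_process_bounded_measurable T w cY) tT.
rewrite [RHS]integral_mkcond; apply: eq_integral => s _.
rewrite /f/= patchE indicE; case: ifPn => st; last by rewrite mulr0.
rewrite mulr1; move: st; rewrite inE/= in_itv/= => /andP[s0 _].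
by rewrite (max_idPl s0).
Qed.

(** Positive and negative parts are treated by Tonelli, so that measurability is available before
    any L^1 bound on [Y]. *)
Lemma time_integral_measurable :
  measurable_fun setT (fun w => \int[mu]_(s in `[0, t]) Y s w).
Proof.
apply/measurable_EFinP.
have -> : EFin \o (fun w => \int[mu]_(s in `[0, t]) Y s w) =
    (fun w => (\int[mu]_s (f^\+ (w, s)) - \int[mu]_s (f^\- (w, s)))%E).
  apply/funext => w /=; rewrite -fE [LHS]integralE.
  by congr (_ - _)%E; apply: eq_integral => s _; rewrite ?funeposE ?funenegE.
apply: emeasurable_funB.
  by apply: measurable_fun_fubini_tonelli_F => //; exact: measurable_funepos.
by apply: measurable_fun_fubini_tonelli_F => //; exact: measurable_funeneg.
Qed.

Let fwE s : 0 <= s <= t -> (fun w => f (w, s)) = EFin \o Y s.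
Proof.
move=> st; apply/funext => w; rewrite /f/= indicE mem_set/= ?in_itv//= mulr1.
by case/andP: st => s0 _; rewrite (max_idPl s0).
Qed.

Hypothesis L1Y : L1_bounded T Y.

Let intf : (P \x mu)%E.-integrable setT f.
Proof.
apply/(integrable21ltyP P mu mf).
have [K hK] := L1Y.
have K0 : 0 <= K.
  rewrite -lee_fin; have := hK 0; rewrite lexx (le_trans t0 tT) => /(_ isT).
  by apply: le_trans; apply: integral_ge0 => w _; rewrite lee_fin.
apply: (@le_lt_trans _ _ (\int[mu]_s (K%:E * (\1_(`[0, t]) s)%:E))%E).
  apply: ge0_le_integralT => s; first by apply: integral_ge0 => w _; rewrite abse_ge0.
  rewrite indicE; case: (boolP (s \in _)) => st; last first.
    rewrite mule0 integral0_eq// => w _; rewrite /f/= indicE (negbTE st) mulr0.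
    by rewrite normr0.
  move: st; rewrite inE/= in_itv/= => st; rewrite mule1.
  have -> : (\int[P]_x `|f (x, s)| = \int[P]_w `|Y s w|%:E)%E.
    by apply: eq_integral => w _; rewrite -[f (w, s)]/((fun w => f (w, s)) w) fwE.
  by apply: hK; case/andP: st => -> st; exact: le_trans st tT.
rewrite ge0_integralZl//; last first.
  by apply/measurable_EFinP; exact: measurable_indic.
rewrite integral_indic//= setIT [X in (_ * X)%E](lebesgue_measure_itv `[0, t])/=.
by case: ifP => _; rewrite ?mule0 ?ltry// -EFinB -EFinM ltry.
Qed.

Lemma process_integrable s : 0 <= s <= T -> P.-integrable setT (EFin \o Y s).
Proof.
move=> sT; apply/integrableP; split.
  by apply/measurable_EFinP; apply: cY.1; case/andP: sT.
have [K hK] := L1Y; exact: le_lt_trans (hK s sT) (ltry _).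
Qed.

Lemma time_integral_integrable :
  P.-integrable setT (EFin \o (fun w => \int[mu]_(s in `[0, t]) Y s w)).
Proof.
have := integrable_fubini_F intf; apply: eq_integrable => // w _.
by rewrite /fubini_F fE.
Qed.

Let mean_fE s : 0 <= s <= t -> (\int[P]_w f (w, s) = (\int[P]_w Y s w)%:E)%E.
Proof.
move=> st; rewrite /Rintegral fineK.
  by rewrite -[in LHS]/(fun w => f (w, s)) fwE.
apply: integrable_fin_num => //; apply: process_integrable.
by case/andP: st => -> /= /le_trans; apply.
Qed.

Lemma mean_measurable : measurable_fun `[0, t] (fun s => \int[P]_w Y s w).
Proof.
apply/measurable_EFinP.
have := measurable_funTS (measurable_fubini_G intf) (D := `[0, t]).
apply: eq_measurable_fun => s; rewrite inE/= in_itv/= => st.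
by rewrite /fubini_G mean_fE.
Qed.

Lemma mean_time_integral :
  \int[P]_w \int[mu]_(s in `[0, t]) Y s w =
  \int[mu]_(s in `[0, t]) \int[P]_w Y s w.
Proof.
have := Fubini intf; under eq_integral do rewrite fE.
move=> E; rewrite {1}/Rintegral E /Rintegral; congr fine.
rewrite [RHS]integral_mkcond; apply: eq_integral => s _.
rewrite patchE; case: ifPn => st.
  by move: st; rewrite inE/= in_itv/= => st; rewrite mean_fE.
by rewrite integral0_eq// => w _; rewrite /f/= indicE (negbTE st) mulr0.
Qed.

End time_integral.

Lemma mean_bounded_measurable T Y : 0 <= T -> continuous_process Y ->
  L1_bounded T Y -> bounded_measurable T (fun s => \int[P]_w Y s w).
Proof.
move=> T0 cY L1Y; split; first exact: mean_measurable L1Y.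
have [K hK] := L1Y; exists K => s sT.
have iY := process_integrable cY L1Y sT.
apply: le_trans (le_normr_Rintegral _ iY) _ => //.
rewrite -lee_fin fineK ?hK//; apply: integrable_fin_num => //.
exact: integrable_norm.
Qed.

Lemma continuous_process_time_integral Y : continuous_process Y ->
  continuous_process (fun t w => \int[mu]_(s in `[0, t]) Y s w).
Proof.
move=> cY; split => [s s0|w]; first exact: time_integral_measurable (lexx s) cY.
apply/halfline_cvgP => x x0.
have [mh [K hK]] := continuous_process_bounded_measurable (x + 1) w cY.
have K0 : 0 <= K by apply: le_trans (hK 0 _); rewrite ?normr_ge0// lexx addr_ge0.
apply/cvgrPdist_le => e e0.
rewrite near_withinE; near=> y => /=; rewrite in_itv/= andbT => y0.
have yx1 : `|x - y| <= 1.
  by near: y; exists 1 => //= z /ltW.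
have yxe : `|x - y| <= e / (K + 1).
  near: y; exists (e / (K + 1)) => /=; last by move=> z /ltW.
  by rewrite divr_gt0// ltr_wpDl.
have yx : y <= x + 1 by move: yx1; rewrite ler_distl => /andP[+ _]; rewrite lerBlDr.
apply: (@le_trans _ _ (K * `|x - y|)); last first.
  rewrite (le_trans (ler_wpM2l K0 yxe))// mulrA ler_pdivrMr ?ltr_wpDl//.
  by rewrite mulrDr mulr1 mulrC lerDl ltW.
have [xy|/ltW yx'] := leP x y.
  have [_ _] := integral_increment mh hK x0 xy yx.
  have -> : `|x - y| = y - x by rewrite distrC ger0_norm ?subr_ge0.
  by rewrite distrC.
have xx1 : x <= x + 1 by rewrite lerDl.
have [_ _] := integral_increment mh hK y0 yx' xx1.
by have -> : `|x - y| = x - y by rewrite ger0_norm ?subr_ge0.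
Unshelve. all: by end_near. Qed.

(** * Linear equations with random forcing and noise *)

Section linear_process.
Variables (T nu y0 K : R) (Y G : R -> Omega -> R).
Hypotheses (T0 : 0 <= T) (nu0 : 0 <= nu).
Hypotheses (cY : continuous_process Y) (cG : continuous_process G).
Hypothesis L1G : L1_bounded T G.
Hypothesis noise : forall t, 0 <= t <= T -> exists J : Omega -> R,
  [/\ measurable_fun setT J, (\int[P]_w `|J w|%:E <= K%:E)%E,
    (\int[P]_w (J w)%:E = 0)%E &
    {ae P, forall w, Y t w =
      y0 + \int[mu]_(s in `[0, t]) (- nu * Y s w + G s w) + J w}].

Let drift s w := - nu * Y s w + G s w.
(** The noise recovered from the equation: at each fixed time it is almost surely the given [J],
    hence has its moments, and unlike the family of the [J] it is continuous along every path. *)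
Let M t w := Y t w + - 1 * (y0 + \int[mu]_(s in `[0, t]) drift s w).

Let cdrift : continuous_process drift.
Proof. by apply: continuous_processD => //; exact: continuous_processZ. Qed.

Let cM : continuous_process M.
Proof.
apply: continuous_processD => //; apply: continuous_processZ.
apply: continuous_processD; first exact: continuous_process_cst.
exact: continuous_process_time_integral.
Qed.

Let YE t w : Y t w = y0 + \int[mu]_(s in `[0, t]) drift s w + M t w.
Proof. by rewrite /M mulN1r addrCA subrr addr0. Qed.

Let M_moments t : 0 <= t <= T -> (\int[P]_w `|M t w|%:E <= K%:E)%E /\
  (\int[P]_w (M t w)%:E = 0)%E.
Proof.
move=> tT; have [J [mJ JK J0 YJ]] := noise tT.
have mM : measurable_fun setT (M t) by apply: cM.1; case/andP: tT.
have MJ : {ae P, forall w, M t w = J w}.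
  apply: filterS YJ => w; rewrite /M mulN1r => ->.
  by rewrite addrAC subrr add0r.
split.
  rewrite (_ : \int[P]_w _ = \int[P]_w `|J w|%:E)%E//.
  apply: ae_eq_integral => //.
  - by apply/measurable_EFinP; exact: measurableT_comp.
  - by apply/measurable_EFinP; exact: measurableT_comp.
  - by apply: filterS MJ => w ->.
rewrite -J0; apply: ae_eq_integral => //.
- exact/measurable_EFinP.
- exact/measurable_EFinP.
- by apply: filterS MJ => w ->.
Qed.

Let L1M : L1_bounded T M.
Proof. by exists K => s sT; case: (M_moments sT). Qed.

(** The pathwise bound involves only [y0], [G] and [M], all with controlled first moments, so no
    Gronwall argument is needed. *)
Lemma linear_process_L1_bounded : L1_bounded T Y.
Proof.
pose H s w := `|G s w| + nu * `|M s w|.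
have cH : continuous_process H.
  apply: continuous_processD; first exact: continuous_process_norm.
  by apply/continuous_processZ/continuous_process_norm.
have [KG hG] := L1G.
have L1H : L1_bounded T H.
  exists (KG + nu * K) => s /[dup] sT /andP[s0 _].
  have mG : measurable_fun setT (G s) := cG.1 s s0.
  have mM : measurable_fun setT (M s) := cM.1 s s0.
  under eq_integral do rewrite ger0_norm ?addr_ge0 ?mulr_ge0// EFinD EFinM.
  rewrite ge0_integralD//; last 3 first.
  - by apply/measurable_EFinP; exact: measurableT_comp.
  - by move=> w _; rewrite -EFinM lee_fin mulr_ge0.
  - by apply: emeasurable_funM => //; apply/measurable_EFinP; exact: measurableT_comp.
  rewrite ge0_integralZl//; last by apply/measurable_EFinP; exact: measurableT_comp.
  rewrite EFinD EFinM leeD ?hG// lee_wpmul2l ?lee_fin//.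
  by case: (M_moments sT).
pose I t w := \int[mu]_(s in `[0, t]) H s w.
have bH := mean_bounded_measurable T0 cH L1H.
have [_ [KI hI]] := bounded_measurable_primitive bH.
exists (`|y0| + KI + K) => t /[dup] tT /andP[t0 tT'].
have mM : measurable_fun setT (M t) := cM.1 t t0.
have I0 w : 0 <= I t w.
  by apply: Rintegral_ge0 => s _; rewrite addr_ge0// mulr_ge0.
have mI : measurable_fun setT (I t) := time_integral_measurable (lexx t) cH.
apply: (@le_trans _ _ (\int[P]_w (`|y0|%:E + ((I t w)%:E + `|M t w|%:E)))%E).
  apply: ge0_le_integralT => w; first by rewrite lee_fin.
  rewrite -!EFinD lee_fin addrA.
  apply: (@linear_equation_norm _ T nu y0 (Y ^~ w) (G ^~ w) (M ^~ w)) tT => //.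
  - exact: continuous_process_bounded_measurable.
  - exact: continuous_process_bounded_measurable.
  - exact: continuous_process_bounded_measurable.
rewrite ge0_integralD//; last 2 first.
- by move=> w _; rewrite -EFinD lee_fin addr_ge0.
- apply: emeasurable_funD; first exact/measurable_EFinP.
  by apply/measurable_EFinP; exact: measurableT_comp.
rewrite ge0_integralD//; last 3 first.
- by move=> w _; rewrite lee_fin.
- exact/measurable_EFinP.
- by apply/measurable_EFinP; exact: measurableT_comp.
rewrite integral_cst//= probability_setT mule1 addeA !EFinD !leeD//.
  have iI := time_integral_integrable t0 tT' cH L1H.
  rewrite -(fineK (integrable_fin_num measurableT iI)) lee_fin.
  have := mean_time_integral t0 tT' cH L1H; rewrite {1}/Rintegral => ->.
  exact: le_trans (ler_norm _) (hI t tT).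
by case: (M_moments tT).
Qed.

Lemma linear_process_mean t : 0 <= t <= T ->
  \int[P]_w Y t w = y0 + \int[mu]_(s in `[0, t])
    (- nu * (\int[P]_w Y s w) + \int[P]_w G s w).
Proof.
move=> /[dup] tT /andP[t0 tT']; have L1Y := linear_process_L1_bounded.
have iY s : 0 <= s <= T -> P.-integrable setT (EFin \o Y s).
  exact: process_integrable.
have iG s : 0 <= s <= T -> P.-integrable setT (EFin \o G s).
  exact: process_integrable.
have iM : P.-integrable setT (EFin \o M t) by exact: process_integrable L1M _ tT.
have L1d : L1_bounded T drift.
  have [KY hY] := L1Y; have [KG hG] := L1G.
  exists (nu * KY + KG) => s /[dup] sT /andP[s0 _].
  have mY : measurable_fun setT (Y s) := cY.1 s s0.
  have mG : measurable_fun setT (G s) := cG.1 s s0.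
  apply: (@le_trans _ _ (\int[P]_w (nu%:E * `|Y s w|%:E + `|G s w|%:E))%E).
    apply: ge0_le_integralT => w; first by rewrite lee_fin.
    rewrite -EFinM -EFinD lee_fin (le_trans (ler_normD _ _))//.
    by rewrite normrM normrN (ger0_norm nu0).
  rewrite ge0_integralD//; last 3 first.
  - by move=> w _; rewrite -EFinM lee_fin mulr_ge0.
  - by apply: emeasurable_funM => //; apply/measurable_EFinP; exact: measurableT_comp.
  - by apply/measurable_EFinP; exact: measurableT_comp.
  rewrite ge0_integralZl//; last by apply/measurable_EFinP; exact: measurableT_comp.
  by rewrite EFinD EFinM leeD ?hG// lee_wpmul2l ?lee_fin// hY.
have id := time_integral_integrable t0 tT' cdrift L1d.
transitivity (\int[P]_w (y0 + \int[mu]_(s in `[0, t]) drift s w + M t w)).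
  by apply: eq_Rintegral => w _; exact: YE.
have iy0 : P.-integrable setT (EFin \o (fun=> y0)).
  exact: finite_measure_integrable_cst.
rewrite RintegralD//; last exact: integrableD iy0 id.
rewrite [X in _ + X]/Rintegral (M_moments tT).2 addr0 RintegralD//.
rewrite Rintegral_cst// [fine (P _)](_ : _ = 1); last by rewrite probability_setT.
rewrite mulr1 (mean_time_integral t0 tT' cdrift L1d); congr (_ + _).
apply: eq_Rintegral => s; rewrite inE/= in_itv/= => /andP[s0 st].
have sT : 0 <= s <= T by rewrite s0 (le_trans st).
rewrite RintegralD//; [|exact: integrableZl (iY s sT)|exact: iG].
by rewrite RintegralZl//; exact: iY.
Qed.

End linear_process.

End continuous_processes.

(** * The cascade *)

Lemma lipschitz_continuous_fun (R : realType) (f : R -> R) :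
  lipschitz (f : R^o -> R^o) -> continuous f.
Proof.
(* [lipschitz] gives the bound for every constant above some [k], possibly negative; [L] is a
   positive one. *)
move=> [k [kR fk]] x; pose L := Num.max k 0 + 1.
have L0 : 0 < L by rewrite ltr_wpDl// le_max lexx orbT.
have {}fk y : `|f x - f y| <= L * `|x - y|.
  have kL : k < L by rewrite ltr_pwDr// le_max lexx.
  exact: (fk L kL (x, y)).
apply/cvgrPdist_le => e e0; near=> y.
apply: le_trans (fk y) _; rewrite -ler_pdivlMl// mulrC.
near: y; exists (e / L) => /=; first by rewrite divr_gt0.
by move=> z /ltW.
Unshelve. all: by end_near. Qed.

Section cascade.
Context (R : realType) (eta : 'I_2 -> nat) (nu c p : 'I_2 -> R)
  (f : 'I_2 -> R -> R) (fmax : 'I_2 -> R).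
Implicit Types (x : state R eta) (k : 'I_2) (q : nat).

Definition rev_index k q : 'I_(\sum_(k < 2) (eta k).+1) :=
  tagnat.Rank k (inord (eta k - q)).

Lemma rev_coord_index x k q : rev_coord x k q = x (rev_index k q) 0.
Proof. by rewrite /rev_coord /block_coord /submxcol mxE. Qed.

Lemma rev_coordD x x' k q : rev_coord (x + x') k q = rev_coord x k q + rev_coord x' k q.
Proof. by rewrite !rev_coord_index mxE. Qed.

Lemma rev_coord_vecB x k q : (q <= eta k)%N -> rev_coord (vecB c f x) k q =
  if q is _.+1 then 0
  else c k * f (ordS k) (rev_coord x (ordS k) (eta (ordS k))).
Proof.
move=> qk; rewrite {1}/rev_coord /block_coord /vecB mxcolK mxE.
rewrite -val_eqE/= inordK ?ltnS ?leq_subr//.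
case: q qk => [_|q qk]; first by rewrite subn0 eqxx rev_coordE subn0.
by case: eqP => // E; exfalso; lia.
Qed.

Lemma matSigma_bounded k q l : assumptionA f fmax -> exists K, forall x,
  `|matSigma c p f x (rev_index k q) l| <= K.
Proof.
move=> fA; exists (`|c k / Num.sqrt (p (ordS k))| * Num.sqrt (fmax (ordS k))) => x.
have -> : matSigma c p f x (rev_index k q) l =
    submxcol (matSigma c p f x) k (inord (eta k - q)) l by rewrite /submxcol [RHS]mxE.
rewrite /matSigma mxcolK mxE; case: ifP => _.
  rewrite normrM ler_wpM2l// ger0_norm ?sqrtr_ge0// ler_wsqrtr//.
  have [_ _ fk] := fA (ordS k).
  by case/andP: (fk (block_coord x (k := ordS k) ord0)).
by rewrite normr0 mulr_ge0// sqrtr_ge0.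
Qed.

Lemma block_coord_chain_bound (b : R) (x0 : state R eta) t k
    (j : 'I_(eta k).+1) : 0 < nu k ->
  block_coord (expmx (t *: matA eta nu) *m x0) j +
    time_factor nu t j * (b / nu k ^+ (eta k - j).+1) =
  chain_bound (nu k) (rev_coord x0 k) b (eta k - j) t.
Proof.
move=> nuk; rewrite rev_coordE rev_coord_expmx ?leq_subr// /chain_bound.
congr (_ + _ * _); rewrite /time_factor /exp_sum big_mkord mulr_sumr.
congr (_ - _); apply: eq_bigr => r _; rewrite /exp_profile (mulrC t) exprMn; ring.
Qed.

(** * Induction along a block *)

Section mean_bounds.
Context d (Omega : measurableType d) (P : probability Omega R).
Context (W : 'I_2 -> R -> Omega -> R) (x0 : state R eta) (N : nat).
Context (X : R -> Omega -> state R eta).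
Hypotheses (nu_gt0 : forall k, 0 < nu k) (c_sign : forall k, c k = -1 \/ c k = 1).
Hypotheses (fA : assumptionA f fmax) (bmW : brownian_motion P W).
Hypothesis solX : strong_solution P W (fun x => matA eta nu *m x + vecB c f x)
    (fun x => (Num.sqrt N%:R)^-1 *: matSigma c p f x) x0 X.

Let Y k q s w := rev_coord (X s w) k q.

(** The driver of a coordinate. [G k q.+1] reduces to [Y k q], so what the induction proves about
    one coordinate is literally the hypothesis on the next driver. *)
Let G k q s w := if q is q'.+1 then Y k q' s w
  else c k * f (ordS k) (Y (ordS k) (eta (ordS k)) s w).

Let cY k q : continuous_process (Y k q).
Proof.
split => [s s0|w].
  apply: (augmented_measurable_fun bmW (t := s)).
  rewrite (_ : Y k q s = fun w => X s w (rev_index k q) 0).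
    exact: (sol_adapted solX).
  by apply/funext => w; exact: rev_coord_index.
rewrite (_ : Y k q ^~ w = fun s => X s w (rev_index k q) 0).
  exact: (sol_continuous solX).
by apply/funext => s; exact: rev_coord_index.
Qed.

Let cG k q : continuous_process (G k q).
Proof.
case: q => [|q]; last exact: cY.
apply: continuous_processZ; apply: continuous_process_comp (cY _ _).
by apply: lipschitz_continuous_fun; case: (fA (ordS k)).
Qed.

Let noise k q T : (q <= eta k)%N -> exists K, forall t, 0 <= t <= T ->
  exists J : Omega -> R,
  [/\ measurable_fun setT J, (\int[P]_w `|J w|%:E <= K%:E)%E,
    (\int[P]_w (J w)%:E = 0)%E &
    {ae P, forall w, Y k q t w = rev_coord x0 k q +
      \int[lebesgue_measure]_(s in `[0, t]) (- nu k * Y k q s w + G k q s w) + J w}].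
Proof.
move=> qk; pose i := rev_index k q.
have /choice [K hK] : forall l, exists K, forall x,
    `|((Num.sqrt N%:R)^-1 *: matSigma c p f x) i l| <= K.
  move=> l; have [K hK] := matSigma_bounded k q l fA.
  exists (`|(Num.sqrt N%:R)^-1| * K) => x.
  by rewrite mxE normrM ler_wpM2l// hK.
(* The first-moment bounds of the two Itô integrals, taken at the final time [T], dominate those at
   every earlier time. *)
exists (\sum_(l < 2) (34 + 32 * K l ^+ 2 * T)) => t /[dup] tT /andP[t0 tT'].
have [J [itoJ eqJ]] := sol_equation solX t0.
have mJ l : measurable_fun setT (J i l) := ito_integral_measurable (itoJ i l).
exists (fun w => \sum_(l < 2) J i l w); split.
- exact: measurable_sum.
- apply: (@le_trans _ _ (\int[P]_w (\sum_(l < 2) `|J i l w|%:E))%E).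
    apply: ge0_le_integralT => w; first by rewrite lee_fin.
    by rewrite sumEFin lee_fin ler_norm_sum.
  rewrite ge0_integral_sum//; last first.
    by move=> l; apply/measurable_EFinP; exact: measurableT_comp.
  rewrite -sumEFin; apply: lee_sum => l _.
  apply: le_trans (ito_integral_abs_le bmW t0 (fun s w => hK l (X s w)) (itoJ i l)) _.
  by rewrite lee_fin lerD2l ler_wpM2l// mulr_ge0// sqr_ge0.
- under eq_integral do rewrite -sumEFin.
  rewrite integral_sum//; last first.
    by move=> l; exact: (ito_integral_integrable bmW t0 (fun s w => hK l (X s w)) (itoJ i l)).
  rewrite big1// => l _.
  exact: (ito_integral_mean bmW t0 (fun s w => hK l (X s w)) (itoJ i l)).
- have := eqJ i; apply: filterS => w.
  rewrite /Y [LHS in _ -> LHS = _]rev_coord_index -/i => ->.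
  rewrite [rev_coord x0 k q]rev_coord_index -/i; congr (_ + _ + _).
  apply: eq_Rintegral => s _; rewrite -rev_coord_index rev_coordD.
  rewrite rev_coord_matA// rev_coord_vecB// -addrA /G /Y; congr (_ + _).
  by case: (q) => [|q']; rewrite ?add0r ?addr0.
Qed.

Let mean k q s := \int[P]_w Y k q s w.

(** [L1_bounded] travels with the two inequalities because the next coordinate needs an integrable
    driver before its mean equation can be derived. *)
Let mean_bounds k q T : (q <= eta k)%N -> 0 <= T ->
  [/\ L1_bounded P T (Y k q),
    forall s, 0 <= s <= T ->
      chain_bound (nu k) (rev_coord x0 k) (Num.min 0 (c k * fmax (ordS k))) q s
        <= mean k q s &
    forall s, 0 <= s <= T -> mean k q s <=
      chain_bound (nu k) (rev_coord x0 k) (Num.max 0 (c k * fmax (ordS k))) q s].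
Proof.
move=> + T0; move: q; set lo := Num.min _ _; set hi := Num.max _ _.
have nu0 : 0 <= nu k := ltW (nu_gt0 k).
have nuN0 : nu k != 0 by rewrite gt_eqF.
pose y := rev_coord x0 k.
(* The constant [b] is left free so that one comparison serves both [lo] and [hi]. *)
have step q : (q <= eta k)%N -> L1_bounded P T (G k q) ->
  L1_bounded P T (Y k q) /\ forall b,
  let v s := if q is q'.+1 then chain_bound (nu k) y b q' s else b in
  ((forall s, 0 <= s <= T -> v s <= \int[P]_w G k q s w) ->
    forall s, 0 <= s <= T -> chain_bound (nu k) y b q s <= mean k q s) /\
  ((forall s, 0 <= s <= T -> \int[P]_w G k q s w <= v s) ->
    forall s, 0 <= s <= T -> mean k q s <= chain_bound (nu k) y b q s).
  move=> qk L1G; have [K hK] := noise T qk.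
  have L1Y := linear_process_L1_bounded T0 nu0 (cY k q) (cG k q) L1G hK.
  split=> // b v.
  have bm := mean_bounded_measurable T0 (cY k q) L1Y.
  have bg := mean_bounded_measurable T0 (cG k q) L1G.
  have bb := chain_bound_bounded_measurable y b q T nuN0.
  have bv : bounded_measurable T v.
    rewrite /v; case: (q) => [|q']; first exact: bounded_measurable_cst.
    exact: chain_bound_bounded_measurable.
  have mE := linear_process_mean T0 nu0 (cY k q) (cG k q) L1G hK.
  have bE s : 0 <= s <= T -> chain_bound (nu k) y b q s = y q +
      \int[lebesgue_measure]_(u in `[0, s]) (- nu k * chain_bound (nu k) y b q u + v u).
    by case/andP => s0 _; exact: chain_bound_integral.
  split => [vg|gv].
    exact: (linear_equation_compare bb bm bv bg nu0 bE mE vg).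
  exact: (linear_equation_compare bm bb bg bv nu0 mE bE gv).
elim=> [|q IH] qk; last first.
  have [L1 lob hib] := IH (ltnW qk); have [L1Y cmp] := step q.+1 qk L1.
  by split => //; [exact: (cmp lo).1|exact: (cmp hi).2].
(* The sign of [c] decides whether the feedback lies between 0 and [fmax] or between [- fmax] and 0;
   in both cases [lo] and [hi] are the two ends. *)
have Gb s w : lo <= G k 0 s w <= hi /\ `|G k 0 s w| <= fmax (ordS k).
  have [_ _ fk] := fA (ordS k).
  have /andP[] := fk (Y (ordS k) (eta (ordS k)) s w); rewrite /G /lo /hi.
  set F := f _ _ => F0 Ff; have f0 := le_trans (ltW F0) Ff.
  case: (c_sign k) => ->; rewrite ?mulN1r ?mul1r ?normrN (ger0_norm (ltW F0)).
    by rewrite ge_min le_max lerN2 Ff !oppr_le0 (ltW F0) orbT.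
  by rewrite ge_min le_max Ff (ltW F0) orbT.
have iG s : 0 <= s -> P.-integrable setT (EFin \o G k 0 s).
  move=> s0; apply: measurable_bounded_integrable => //.
  - by rewrite [ltLHS]probability_setT ltry.
  - exact: (cG k 0).1.
  - exists (fmax (ordS k)); split; first exact: num_real.
    by move=> x Kx w _; apply: le_trans (ltW Kx); exact: (Gb s w).2.
have icst a : \int[P]_(w in setT) a = a.
  by rewrite Rintegral_cst// [fine (P _)](_ : _ = 1) ?mulr1// probability_setT.
have L1G : L1_bounded P T (G k 0).
  exists (fmax (ordS k)) => s sT.
  rewrite -[leRHS](_ : (\int[P]__ (fmax (ordS k))%:E)%E = _); last first.
    by rewrite integral_cst//= probability_setT mule1.
  apply: ge0_le_integralT => w; first by rewrite lee_fin.
  by rewrite lee_fin (Gb s w).2.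
have [L1Y cmp] := step 0%N qk L1G; split => //.
- apply: (cmp lo).1 => s /andP[s0 _]; rewrite -(icst lo).
  apply: le_Rintegral => //; [|exact: iG|by move=> w _; case/andP: (Gb s w).1].
  exact: finite_measure_integrable_cst.
- apply: (cmp hi).2 => s /andP[s0 _]; rewrite -[leRHS](icst hi).
  apply: le_Rintegral => //; [exact: iG| |by move=> w _; case/andP: (Gb s w).1].
  exact: finite_measure_integrable_cst.
Qed.

Lemma cascade_mean_bounds t k (j : 'I_(eta k).+1) : 0 <= t ->
  ((Imin nu c fmax x0 t j)%:E <= 'E_P[fun w => block_coord (X t w) j]
     <= (Imax nu c fmax x0 t j)%:E)%E.
Proof.
move=> t0; have tt : 0 <= t <= t by rewrite t0 lexx.
have [L1Y lo hi] := mean_bounds (leq_subr j (eta k)) t0.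
have iY := process_integrable (cY k (eta k - j)) L1Y tt.
have -> : ('E_P[fun w => block_coord (X t w) j] = (mean k (eta k - j) t)%:E)%E.
  rewrite unlock /mean /Rintegral fineK ?integrable_fin_num//.
  by apply: eq_integral => w _; rewrite /Y rev_coordE.
have nuV : 0 <= (nu k ^+ (eta k - j).+1)^-1 by rewrite invr_ge0 exprn_ge0// ltW.
rewrite !lee_fin /Imin /Imax /asymptote.
(* Division by a positive power of [nu] commutes with [min] and [max], which turns the asymptote
   into the equilibrium for the forcing [lo] or [hi]. *)
rewrite -{1}(mul0r (nu k ^+ (eta k - j).+1)^-1) -minr_pMl// block_coord_chain_bound// lo//=.
by rewrite -{1}(mul0r (nu k ^+ (eta k - j).+1)^-1) -maxr_pMl// block_coord_chain_bound// hi.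
Qed.

End mean_bounds.
End cascade.

Unset Implicit Arguments.
Set Strict Implicit.

Theorem theorem3 (R : realType) (eta : 'I_2 -> nat) (nu c p : 'I_2 -> R)
    (N : nat) (f : 'I_2 -> R -> R) (fmax : 'I_2 -> R)
    (d : measure_display) (Omega : measurableType d) (P : probability Omega R)
    (W : 'I_2 -> R -> Omega -> R) (x0 : state R eta)
    (X : R -> Omega -> state R eta) :
  (forall k, (1 <= eta k)%N) ->
  (forall k, 0 < nu k) ->
  (forall k, c k = -1 \/ c k = 1) ->
  (1 <= N)%N ->
  (forall k, 0 < p k) -> \sum_(k < 2) p k = 1 ->
  assumptionA f fmax ->
  brownian_motion P W ->
  strong_solution P W (fun x => matA eta nu *m x + vecB c f x)
    (fun x => (Num.sqrt N%:R)^-1 *: matSigma c p f x) x0 X ->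
  forall t : R, 0 <= t -> forall (k : 'I_2) (j : 'I_(eta k).+1),
  ((Imin nu c fmax x0 t j)%:E <= 'E_P[fun w => block_coord (X t w) j]
     <= (Imax nu c fmax x0 t j)%:E)%E.
Proof.
move=> _ nu_gt0 c_sign _ _ _ fA bmW solX t t0 k j.
exact: (cascade_mean_bounds nu_gt0 c_sign fA bmW solX).
Qed.
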